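(* The flat-virtual bracket $K\mapsto\langle K\rangle_{flat}$ on flat-virtual link diagrams is invariant under all flat-virtual Reidemeister moves except for the first classical Reidemeister move. Moreover, for an oriented flat-virtual link diagram $\bar K$ with underlying non-oriented diagram $K$ and classical writhe number $w(\bar K)$, define the flat-virtual Jones polynomial $$J_f(\bar K)=(-a)^{-3w(\bar K)}\langle K\rangle_{flat}.$$ Then $J_f$ is an invariant of (oriented) flat-virtual links.
   Context: A flat-virtual link diagram is a four-valent graph in the plane (crossing-free circles allowed) each of whose vertices is classical (one pair of opposite edges is marked as the overcrossing strand), flat, or virtual. A flat-virtual link is an equivalence class of such diagrams modulo planar isotopy and the following moves and their inverses (the flat-virtual Reidemeister moves): (1) the classical Reidemeister moves 1, 2, 3, involving classical crossings only; (2) the flat second and third Reidemeister moves, involving flat crossings only and obtained from the classical ones by forgetting over/under information; (3) the mixed flat-classical third Reidemeister move: a strand containing two consecutive flat crossings passes through a classical crossing, whose over/under structure is preserved; (4) the detour move: a strand containing only virtual crossings and virtual self-crossings is removed and replaced by another strand with the same endpoints, all of whose new intersections are marked as virtual crossings. Oriented flat-virtual links are defined in the same way with orientations on the components. The classical writhe $w(\bar K)$ is the sum of the signs of the classical crossings. The target module. Let $\mathbb{Z}[a,a^{-1}]\mathcal{G}_f$ denote the quotient of the free $\mathbb{Z}[a,a^{-1}]$-module generated by plane diagrams with flat and virtual crossings only, by the relations: diagrams related by planar isotopy, by a flat second Reidemeister move, by a flat third Reidemeister move, or by a detour move are equal; and $K\sqcup\bigcirc=(-a^{2}-a^{-2})K$,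 where $K\sqcup\bigcirc$ is obtained from $K$ by adding a separate circle without crossings. The bracket. Each classical crossing of a diagram $K$ can be smoothed in two ways: the $A$-smoothing, with weight $a$, joins the two regions swept by the overcrossing strand when it is rotated counterclockwise towards the undercrossing strand; the $B$-smoothing, with weight $a^{-1}$, is the other one. Flat and virtual crossings are not smoothed. For a state $s$ (a choice of smoothing at every classical crossing) let $\alpha(s)$, $\beta(s)$ be the numbers of $A$- and $B$-smoothings and let $K_s$ be the resulting diagram with flat and virtual crossings only. Then $$\langle K\rangle_{flat}=\sum_s a^{\alpha(s)-\beta(s)}K_s\in\mathbb{Z}[a,a^{-1}]\mathcal{G}_f.$$ *)

(* Defs.v *)
From HB Require Import structures.
From mathcomp Require Import all_boot all_order all_algebra.
From mathcomp Require Import boolp monalg.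
From Stdlib Require Import Relation_Operators.

Set Implicit Arguments.
Unset Strict Implicit.
Unset Printing Implicit Defensive.

Import GRing.Theory.
Local Open Scope ring_scope.

(* The ring Z[a, a^-1], as the subring of Z(a) of the fractions with          *)
(* denominator a power of a.                                                  *)

Definition is_laurent (f : {fraction {poly int}}) : bool :=
  `[< exists (n : nat) (p : {poly int}), f * (tofrac 'X) ^+ n = tofrac p >].

Lemma is_laurentP f : reflect
  (exists (n : nat) (p : {poly int}), f * (tofrac 'X) ^+ n = tofrac p)
  (is_laurent f).
Proof. exact: asboolP. Qed.

Fact is_laurent_subring : subring_closed is_laurent.
Proof.
split.
- by apply/is_laurentP; exists 0%N, 1; rewrite expr0 mulr1 tofrac1.
- move=> f g /is_laurentP[m [p fp]] /is_laurentP[n [q gq]].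
  apply/is_laurentP; exists (m + n)%N, (p * 'X^n - q * 'X^m).
  rewrite tofracB !tofracM !tofracXn -fp -gq mulrBl exprD -!mulrA; congr (_ - _).
  by congr (_ * _); rewrite mulrC.
- move=> f g /is_laurentP[m [p fp]] /is_laurentP[n [q gq]].
  apply/is_laurentP; exists (m + n)%N, (p * q).
  by rewrite tofracM -fp -gq exprD mulrACA.
Qed.

HB.instance Definition _ :=
  GRing.isSubringClosed.Build {fraction {poly int}} is_laurent
    is_laurent_subring.

Record laurent := Laurent { frac_of :> {fraction {poly int}};
                            _ : frac_of \in is_laurent }.

HB.instance Definition _ := [isSub for frac_of].
HB.instance Definition _ := [Choice of laurent by <:].
HB.instance Definition _ := [SubChoice_isSubComNzRing of laurent by <:].

Definition laurent_unit (x : laurent) : bool :=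
  (frac_of x != 0) && is_laurent (frac_of x)^-1.
Definition laurent_inv (x : laurent) : laurent :=
  if laurent_unit x then insubd x (frac_of x)^-1 else x.

Fact laurent_mulVx : {in laurent_unit, left_inverse 1 laurent_inv *%R}.
Proof.
move=> x; rewrite -[x \in _]/(laurent_unit x) => ux; apply: val_inj.
rewrite rmorphM rmorph1 /= /laurent_inv ux.
by case/andP: ux => x0 xL; rewrite insubdK // mulVf.
Qed.

Fact laurent_unitPl (x y : laurent) : y * x = 1 -> laurent_unit x.
Proof.
move=> /(congr1 val); rewrite rmorphM rmorph1 /= => yx1.
have x0 : frac_of x != 0.
  by apply: contra_eq_neq yx1 => ->; rewrite mulr0 eq_sym oner_eq0.
rewrite /laurent_unit x0 /=; suff -> : (frac_of x)^-1 = frac_of y by case: y {yx1}.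
by rewrite -[LHS]mul1r -yx1 mulfK.
Qed.

Fact laurent_inv_out : {in [predC laurent_unit], laurent_inv =1 id}.
Proof.
move=> x; rewrite inE -[x \in _]/(laurent_unit x) => /negPf ux.
by rewrite /laurent_inv ux.
Qed.

HB.instance Definition _ := GRing.ComNzRing_hasMulInverse.Build laurent
  laurent_mulVx laurent_unitPl laurent_inv_out.

Fact is_laurentX : tofrac 'X \in is_laurent.
Proof. by apply/is_laurentP; exists 0%N, 'X; rewrite expr0 mulr1. Qed.

Definition la : laurent := Laurent is_laurentX.

Lemma la_unit : la \is a GRing.unit.
Proof.
rewrite unfold_in /= /laurent_unit /= tofrac_eq0 polyX_eq0 /=.
by apply/is_laurentP; exists 1%N, 1; rewrite expr1 tofrac1 mulVf // tofrac_eq0 polyX_eq0.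
Qed.

(* A plane diagram in general position with respect to the height function    *)
(* (both strands through a vertex are transverse to the horizontal line       *)
(* there, and the events below have distinct heights), read from bottom to    *)
(* top, is the list of its minima, maxima and vertices. Each of them comes    *)
(* with the number of strands to its left.                                    *)
(* Strands carry labels in L, and the two legs of a minimum or of a maximum   *)
(* carry labels exchanged by op. Plain diagrams are the case L = unit; for    *)
(* L = bool and op = negb a label tells whether the strand is oriented        *)
(* upwards, so that a labelled diagram is an oriented diagram.                *)

(* Classical true: the overcrossing strand runs from bottom left to top right. *)
Inductive vertex := Classical of bool | Flat | Virtual.

Definition vertex_code v :=
  match v with Classical b => inl b | Flat => inr true | Virtual => inr false end.
Definition vertex_decode (c : bool + bool) :=
  match c with inl b => Classical b | inr true => Flat | inr false => Virtual end.
Fact vertex_codeK : cancel vertex_code vertex_decode.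
Proof. by case. Qed.
HB.instance Definition _ := Countable.copy vertex (can_type vertex_codeK).

(* In Min k c the left leg has label c, hence the right one has label op c.  *)
Inductive event (L : Type) :=
  | Min of nat & L
  | Max of nat
  | Vertex of nat & vertex.
Arguments Max {L}.
Arguments Vertex {L}.

Definition event_code L (e : event L) : nat * L + (nat + nat * vertex) :=
  match e with
  | Min k c => inl (k, c)
  | Max k => inr (inl k)
  | Vertex k v => inr (inr (k, v))
  end.
Definition event_decode L (c : nat * L + (nat + nat * vertex)) : event L :=
  match c with
  | inl (k, c) => Min k c
  | inr (inl k) => Max k
  | inr (inr (k, v)) => Vertex k v
  end.
Fact event_codeK L : cancel (@event_code L) (@event_decode L).
Proof. by case. Qed.
HB.instance Definition _ (L : choiceType) :=
  Choice.copy (event L) (can_type (@event_codeK L)).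

Section Diagrams.
Variables (L : choiceType) (op : L -> L).
Implicit Types (s t : seq L) (e : event L) (w : seq (event L)).

(* The labels, from left to right, of the strands just above e, given those   *)
(* just below; None if e cannot take place there.                             *)
Definition act s e : option (seq L) :=
  match e with
  | Min k c =>
      if (k <= size s)%N then Some (take k s ++ [:: c, op c & drop k s])
      else None
  | Max k =>
      if drop k s is c :: d :: s' then
        if d == op c then Some (take k s ++ s') else None
      else None
  | Vertex k v =>
      if drop k s is c :: d :: s' then Some (take k s ++ [:: d, c & s'])
      else None
  end.

Fixpoint run s w : option (seq L) :=
  if w is e :: w' then obind (run^~ w') (act s e) else Some s.

Record diagram := Diagram { word :> seq (event L);
                            _ : run [::] word == Some [::] }.
HB.instance Definition _ := [isSub for word].
HB.instance Definition _ := [Choice of diagram by <:].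

Definition forget_label e : event unit :=
  match e with
  | Min k _ => Min k tt
  | Max k => Max k
  | Vertex k v => Vertex k v
  end.

End Diagrams.

Notation udiagram := (diagram (@id unit)).
Notation odiagram := (diagram negb).

Lemma run_forget (L : choiceType) (op : L -> L) (s t : seq L) w :
  run op s w = Some t ->
  run id [seq tt | _ <- s] [seq forget_label e | e <- w] = Some [seq tt | _ <- t].
Proof.
elim: w s => [s [<-] //|e w IHw s] /=.
case Es: (act op s e) => [s'|//] /= /IHw <-.
suff -> : act id [seq tt | _ <- s] (forget_label e) = Some [seq tt | _ <- s'] by [].
case: e Es => [k c|k|k v] /=; rewrite ?size_map -?map_drop -?map_take.
- by case: ifP => // _ [<-]; rewrite map_cat.
- by case: drop => [|x [|y r]] //=; case: ifP => // _ [<-]; rewrite map_cat.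
- by case: drop => [|x [|y r]] //= [<-]; rewrite map_cat.
Qed.

Fact underlying_subproof (D : odiagram) :
  run id [::] [seq forget_label e | e <- D] == Some [::].
Proof. by case: D => w /= /eqP /run_forget ->. Qed.

Definition underlying (D : odiagram) : udiagram := Diagram (underlying_subproof D).

(* Local moves are given by pairs of words that may be substituted for one    *)
(* another. The pictures are not drawn in all positions: the other ones       *)
(* (rotated bigons, triangles and so on) follow by planar isotopy.            *)

Notation uword := (seq (event unit)).

(* Numbers of strands below and above an event. *)
Definition legs_in (e : event unit) : nat := if e is Min _ _ then 0 else 2.
Definition legs_out (e : event unit) : nat := if e is Max _ then 0 else 2.

Definition at_pos (k : nat) (e : event unit) : event unit :=
  match e with
  | Min _ c => Min k c
  | Max _ => Max k
  | Vertex _ v => Vertex k v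
  end.

(* Turning a vertex by a quarter of a full turn. *)
Definition quarter (v : vertex) : vertex :=
  if v is Classical b then Classical (~~ b) else v.

(* A generic planar isotopy keeps a diagram in general position except at     *)
(* finitely many moments: two events at different places exchange heights, a  *)
(* minimum and a maximum cancel (or appear), or a strand through a vertex     *)
(* becomes horizontal there, so that the vertex slides across an extremum.    *)
(* Planar isotopy is the equivalence relation generated by these.             *)
Inductive isotopy_rule : uword -> uword -> Prop :=
  | Exchange k m e f :
      isotopy_rule [:: at_pos (k + legs_in e + m) f; at_pos k e]
                   [:: at_pos k e; at_pos (k + legs_out e + m) f]
  | Cancel_left k : isotopy_rule [:: Min k tt; Max k.+1] [::]
  | Cancel_right k : isotopy_rule [:: Min k.+1 tt; Max k] [::]
  | Slide_max k v :
      isotopy_rule [:: Vertex k v; Max k.+1] [:: Vertex k.+1 (quarter v); Max k]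
  | Slide_min k v :
      isotopy_rule [:: Min k.+1 tt; Vertex k v] [:: Min k tt; Vertex k.+1 (quarter v)].

Inductive classical1_rule : uword -> uword -> Prop :=
  | Kink_right k b :
      classical1_rule [:: Min k.+1 tt; Vertex k (Classical b); Max k.+1] [::]
  | Kink_left k b :
      classical1_rule [:: Min k tt; Vertex k.+1 (Classical b); Max k] [::].

Inductive classical2_rule : uword -> uword -> Prop :=
  | Classical2 k b :
      classical2_rule [:: Vertex k (Classical b); Vertex k (Classical (~~ b))] [::].

Inductive flat2_rule : uword -> uword -> Prop :=
  | Flat2 k : flat2_rule [:: Vertex k Flat; Vertex k Flat] [::].

(* Three strands crossing pairwise, in the two possible orders; v12 is the    *)
(* vertex of the first two strands, counted from the left at the bottom.      *)
Definition triangle_up k (v12 v13 v23 : vertex) : uword :=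
  [:: Vertex k v12; Vertex k.+1 v13; Vertex k v23].
Definition triangle_down k (v12 v13 v23 : vertex) : uword :=
  [:: Vertex k.+1 v23; Vertex k v13; Vertex k.+1 v12].

(* b12 says that the first strand passes over the second, and so on; the      *)
(* condition is that the three strands are not cyclically above each other.   *)
Inductive classical3_rule : uword -> uword -> Prop :=
  | Classical3 k (b12 b13 b23 : bool) of (b12 == b23) ==> (b13 == b12) :
      classical3_rule
        (triangle_up k (Classical b12) (Classical b13) (Classical b23))
        (triangle_down k (Classical b12) (Classical b13) (Classical b23)).

Inductive flat3_rule : uword -> uword -> Prop :=
  | Flat3 k : flat3_rule (triangle_up k Flat Flat Flat)
                         (triangle_down k Flat Flat Flat).

Inductive mixed3_rule : uword -> uword -> Prop :=
  | Mixed3_12 k b : mixed3_rule (triangle_up k (Classical b) Flat Flat)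
                                (triangle_down k (Classical b) Flat Flat)
  | Mixed3_13 k b : mixed3_rule (triangle_up k Flat (Classical b) Flat)
                                (triangle_down k Flat (Classical b) Flat)
  | Mixed3_23 k b : mixed3_rule (triangle_up k Flat Flat (Classical b))
                                (triangle_down k Flat Flat (Classical b)).

(* D' is obtained from D by substituting v for u, inside a disc: labels agree *)
(* on the boundary of the disc.                                               *)
Definition local_move (L : choiceType) (op : L -> L)
    (rule : uword -> uword -> Prop) (D D' : diagram op) : Prop :=
  exists (pre u v post : seq (event L)) (s t : seq L),
    [/\ word D = pre ++ u ++ post, word D' = pre ++ v ++ post &
     [/\ rule [seq forget_label e | e <- u] [seq forget_label e | e <- v],
      run op [::] pre = Some s, run op s u = Some t & run op s v = Some t]].

(* The detour move. The strand to be replaced is coloured: a coloured diagram *)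
(* has labels in bool * L, the boolean telling the coloured strands, and has  *)
(* additional events inr k at which the colour of the strand in position k    *)
(* changes.                                                                   *)

Section Detour.
Variables (L : choiceType) (op : L -> L).

Notation cevent := (event (bool * L) + nat)%type.
Implicit Types (s : seq (bool * L)) (R : seq cevent).

Definition cop (c : bool * L) : bool * L := (c.1, op c.2).

(* Vertices on the coloured strand have to be virtual. *)
Definition allowed s (e : event (bool * L)) : bool :=
  if e is Vertex k v then has fst (take 2 (drop k s)) ==> (v == Virtual)
  else true.

Definition cact s (x : cevent) : option (seq (bool * L)) :=
  match x with
  | inl e => if allowed s e then act cop s e else None
  | inr k =>
      if drop k s is c :: s' then Some (take k s ++ (~~ c.1, c.2) :: s')
      else None
  end.

Fixpoint crun s R : option (seq (bool * L)) :=
  if R is x :: R' then obind (crun^~ R') (cact s x) else Some s.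

Definition uncolour (x : cevent) : seq (event L) :=
  match x with
  | inl (Min k c) => [:: Min k c.2]
  | inl (Max k) => [:: Max k]
  | inl (Vertex k v) => [:: Vertex k v]
  | inr _ => [::]
  end.

(* The part of a coloured diagram of a given colour b: a diagram with         *)
(* endpoints, inr (up, k, c) being an endpoint of a strand labelled c which   *)
(* is above that point if up, and below it otherwise. Positions are counted   *)
(* among the strands of colour b only.                                        *)
Notation pevent := (event L + bool * nat * L)%type.

Definition part_event (b : bool) s (x : cevent) : seq pevent :=
  let pos k := count (fun c => c.1 == b) (take k s) in
  let all_b k := all (fun c => c.1 == b) (take 2 (drop k s)) in
  match x with
  | inl (Min k c) => if c.1 == b then [:: inl (Min (pos k) c.2)] else [::]
  | inl (Max k) => if all_b k then [:: inl (Max (pos k))] else [::]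
  | inl (Vertex k v) => if all_b k then [:: inl (Vertex (pos k) v)] else [::]
  | inr k => if drop k s is c :: _ then [:: inr (c.1 != b, pos k, c.2)] else [::]
  end.

Fixpoint part (b : bool) s R : seq pevent :=
  if R is x :: R' then
    part_event b s x ++ (if cact s x is Some s' then part b s' R' else [::])
  else [::].

(* A closed component shows up at the maximum that closes it up: strands are  *)
(* numbered from bottom to top, n being the next number, in such a way that   *)
(* strands have the same number iff they are connected below.                 *)
Fixpoint no_closed_component (n : nat) (s : seq nat) (P : seq pevent) : bool :=
  match P with
  | [::] => true
  | inl (Min k _) :: P' =>
      no_closed_component n.+1 (take k s ++ [:: n, n & drop k s]) P'
  | inl (Max k) :: P' =>
      if drop k s is i :: j :: s' then
        (i != j) && no_closed_component n
                      [seq if h == i then j else h | h <- take k s ++ s'] P'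
      else false
  | inl (Vertex k _) :: P' =>
      if drop k s is i :: j :: s' then
        no_closed_component n (take k s ++ [:: j, i & s']) P'
      else false
  | inr (true, k, _) :: P' =>
      no_closed_component n.+1 (take k s ++ n :: drop k s) P'
  | inr (false, k, _) :: P' =>
      no_closed_component n (take k s ++ drop k.+1 s) P'
  end.

Definition is_endpoint (x : pevent) : bool := if x is inr _ then true else false.

Definition single_arc (P : seq pevent) : bool :=
  (count is_endpoint P == 2) && no_closed_component 0 [::] P.

(* R is D with a strand without classical and flat crossings coloured. *)
Definition marks_strand (D : diagram op) (R : seq cevent) : Prop :=
  [/\ crun [::] R = Some [::], flatten [seq uncolour x | x <- R] = D &
      single_arc (part true [::] R)].

(* The rest of the diagram, with the two endpoints of the strand, is the      *)
(* same. Putting both strands and the rest in general position at once, one   *)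
(* sees that asking for equal words is no restriction up to planar isotopy.   *)
Definition detour (D D' : diagram op) : Prop :=
  exists R R', [/\ marks_strand D R, marks_strand D' R' &
                   part false [::] R = part false [::] R'].

End Detour.

Inductive move :=
  | PlanarIsotopy
  | ClassicalR1 | ClassicalR2 | ClassicalR3
  | FlatR2 | FlatR3
  | MixedR3
  | DetourMove.

Definition related_by (L : choiceType) (op : L -> L) (m : move)
    (D D' : diagram op) : Prop :=
  match m with
  | PlanarIsotopy => local_move isotopy_rule D D'
  | ClassicalR1 => local_move classical1_rule D D'
  | ClassicalR2 => local_move classical2_rule D D'
  | ClassicalR3 => local_move classical3_rule D D'
  | FlatR2 => local_move flat2_rule D D'
  | FlatR3 => local_move flat3_rule D D'
  | MixedR3 => local_move mixed3_rule D D'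
  | DetourMove => detour D D'
  end.

(* Flat-virtual links (oriented ones, if op = negb) are the classes of this   *)
(* relation.                                                                  *)
Definition same_link (L : choiceType) (op : L -> L) :
    diagram op -> diagram op -> Prop :=
  clos_refl_sym_trans (diagram op) (fun D D' => exists m, related_by m D D').

(* The module Z[a, a^-1] G_f *)

Definition is_classical L (e : event L) : bool :=
  if e is Vertex _ (Classical _) then true else false.

Record fdiagram := Fdiagram { fdiagram_val :> udiagram;
                              _ : ~~ has (@is_classical unit) fdiagram_val }.
HB.instance Definition _ := [isSub for fdiagram_val].
HB.instance Definition _ := [Choice of fdiagram by <:].

(* k is arbitrary: the circle may be put into any region of the diagram.      *)
Definition adds_circle (D D' : udiagram) : Prop :=
  exists (pre post : uword) (k : nat),
    word D = pre ++ post /\ word D' = pre ++ [:: Min k tt; Max k] ++ post.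

Notation free_module := {malg laurent[fdiagram]}.
Definition gen (D : fdiagram) : free_module := << D >>.

Inductive relator : free_module -> Prop :=
  | Rel_isotopy (D D' : fdiagram) of related_by PlanarIsotopy D D' :
      relator (gen D - gen D')
  | Rel_flat2 (D D' : fdiagram) of related_by FlatR2 D D' :
      relator (gen D - gen D')
  | Rel_flat3 (D D' : fdiagram) of related_by FlatR3 D D' :
      relator (gen D - gen D')
  | Rel_detour (D D' : fdiagram) of related_by DetourMove D D' :
      relator (gen D - gen D')
  | Rel_circle (D D' : fdiagram) of adds_circle D D' :
      relator (gen D' - (- la ^+ 2 - la ^- 2) *: gen D).

Definition relations (x : free_module) : bool :=
  `[< exists r : seq (laurent * free_module),
        (forall p, p \in r -> relator p.2) /\ x = \sum_(p <- r) p.1 *: p.2 >].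

Fact relations_submod : submod_closed relations.
Proof.
split; first by apply/asboolP; exists [::]; rewrite big_nil.
move=> c x y /asboolP[r [rr ->]] /asboolP[q [rq ->]]; apply/asboolP.
exists ([seq (c * p.1, p.2) | p <- r] ++ q); split=> [p|].
  by rewrite mem_cat => /orP[/mapP[p' /rr rp' ->]|/rq].
rewrite big_cat big_map scaler_sumr /=; congr (_ + _).
by apply: eq_bigr => p _; rewrite scalerA.
Qed.

HB.instance Definition _ :=
  GRing.isSubmodClosed.Build laurent free_module relations relations_submod.

Definition relation_module : zmodClosed free_module :=
  GRing.ZmodClosed.clone free_module relations _.

Definition Gf := {ideal_quot relation_module}.
HB.instance Definition _ := GRing.Zmodule.on Gf.

Definition class_of (x : free_module) : Gf := (\pi_Gf x)%qT.

Lemma class_of_eq x y : class_of x = class_of y <-> relations (x - y).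
Proof.
rewrite -[relations _]/(x - y \in relations) Quotient.idealrBE.
by split=> [?|/eqP //]; apply/eqP.
Qed.

Lemma class_of_repr (x : Gf) : class_of (repr x) = x.
Proof. exact: reprK. Qed.

Definition gscale (c : laurent) (x : Gf) : Gf := class_of (c *: repr x).

Lemma class_ofZ c x : class_of (c *: x) = gscale c (class_of x).
Proof.
apply/class_of_eq; rewrite -scalerBr -[relations _]/(_ \in relations) rpredZ //.
by apply/class_of_eq; rewrite class_of_repr.
Qed.

Lemma class_ofD : {morph class_of : x y / x + y}.
Proof. by move=> x y; rewrite /class_of piE. Qed.

Fact gscaleA c d x : gscale c (gscale d x) = gscale (c * d) x.
Proof. by rewrite -[x]class_of_repr -!class_ofZ scalerA. Qed.
Fact gscale1 : left_id 1 gscale.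
Proof. by move=> x; rewrite -[x]class_of_repr -class_ofZ scale1r. Qed.
Fact gscaleDr : right_distributive gscale +%R.
Proof.
move=> c x y; rewrite -[x]class_of_repr -[y]class_of_repr.
by rewrite -[LHS]/(gscale c (class_of _ + class_of _)) -class_ofD -!class_ofZ
  scalerDr class_ofD.
Qed.
Fact gscaleDl x : {morph gscale^~ x : c d / c + d}.
Proof.
by move=> c d; rewrite -[x]class_of_repr -!class_ofZ scalerDl class_ofD.
Qed.
HB.instance Definition _ := GRing.Zmodule_isLmodule.Build laurent Gf
  gscaleA gscale1 gscaleDr gscaleDl.

(* A = true is the A-smoothing. When b holds, turning the overcrossing strand *)
(* counterclockwise sweeps the regions above and below the vertex, and the    *)
(* A-smoothing is a pair of vertical strands.                                 *)
Definition smooth_vertex (A : bool) (k : nat) (b : bool) : uword :=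
  if A == b then [::] else [:: Max k; Min k tt].

Fixpoint smooth_word (s : seq bool) (w : uword) : uword :=
  match w with
  | [::] => [::]
  | Vertex k (Classical b) :: w' =>
      smooth_vertex (head true s) k b ++ smooth_word (behead s) w'
  | e :: w' => e :: smooth_word s w'
  end.

Lemma run_smooth s t w :
  run id t w != None -> run id t (smooth_word s w) = run id t w.
Proof.
elim: w s t => [//|e w IHw] s t /=.
case: e => [k c|k|k [b| |]] /=.
- by case: ifP => //= _; apply: IHw.
- by case: drop => [|[] [|[] r]] //=; apply: IHw.
- case Et: (drop k t) => [|[] [|[] r]] //= wt.
  have t_eq : take k t ++ [:: tt, tt & r] = t by rewrite -Et cat_take_drop.
  rewrite t_eq in wt *.
  rewrite /smooth_vertex; case: ifP => _ /=; first exact: IHw.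
  have k_lt : (k <= size t)%N.
    by rewrite leqNgt; apply/negP => /ltnW/drop_oversize; rewrite Et.
  have k_size : size (take k t) = k by rewrite size_takel.
  rewrite Et /= size_cat k_size leq_addr take_cat drop_cat k_size ltnn subnn.
  by rewrite take0 drop0 cats0 /= t_eq; apply: IHw.
- by case: drop => [|x [|y r]] //=; apply: IHw.
- by case: drop => [|x [|y r]] //=; apply: IHw.
Qed.

Lemma smooth_flat s w : ~~ has (@is_classical unit) (smooth_word s w).
Proof.
elim: w s => [//|e w IHw] s.
case: e => [k c|k|k [b| |]] //=.
by rewrite has_cat negb_or IHw andbT /smooth_vertex; case: ifP.
Qed.

Fact smooth_subproof (s : seq bool) (K : udiagram) :
  run id [::] (smooth_word s K) == Some [::].
Proof. by case: K => w /= /eqP Kw; rewrite run_smooth Kw. Qed.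

Definition smooth (s : seq bool) (K : udiagram) : fdiagram :=
  @Fdiagram (Diagram (smooth_subproof s K)) (smooth_flat s K).

Definition bracket (K : udiagram) : Gf :=
  \sum_(s : (count (@is_classical unit) K).-tuple bool)
    la ^ ((count_mem true s)%:Z - (count_mem false s)%:Z)
      *: class_of (gen (smooth s K)).

(* s lists the orientations just below the vertex. With both strands going up *)
(* or both going down, the crossing is positive when the strand from bottom   *)
(* left to top right is above.                                                *)
Definition vertex_sign (s : seq bool) (e : event bool) : int :=
  if e is Vertex k (Classical b) then
    if b == (nth true s k == nth true s k.+1) then 1 else -1
  else 0.

Fixpoint word_writhe (s : seq bool) (w : seq (event bool)) : int :=
  if w is e :: w' then
    vertex_sign s e + (if act negb s e is Some s' then word_writhe s' w' else 0)
  else 0.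

Definition writhe (D : odiagram) : int := word_writhe [::] D.

Definition jones (D : odiagram) : Gf :=
  (- la) ^ (- 3 * writhe D) *: bracket (underlying D).

(* Main.v *)
Require Import Defs.
From mathcomp Require Import all_boot all_algebra.
From mathcomp Require Import boolp monalg zify ring.

Set Implicit Arguments.
Unset Strict Implicit.
Unset Printing Implicit Defensive.

Import GRing.Theory.
Local Open Scope ring_scope.

(** The bracket is a state sum, so a move made inside a disc can be checked
inside that disc. The local calculus works with words that may be put above
some number n of strands: two of them are skein equivalent when their
expansions agree under every functional on flat words that satisfies the
relations of the module (flat isotopy, flat moves, circle removal). Since these
functionals are stable under putting fixed words around the argument and under
summation over states, skein equivalence is a congruence, and the class of a
closed flat diagram is one of these functionals.

In this calculus Kauffman's argument goes through. Planar isotopies of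
classical vertices follow by smoothing them: a quarter turn exchanges the two
smoothings, up to zigzags which straighten. In the second classical move the
coefficient of the unwanted state is a^2 + delta + a^-2 = 0, where delta is the
value of a circle. In every third move that contains a classical vertex some
classical vertex can be chosen such that the third strand meets the two
strands through it in the same way. Smoothing that vertex leaves the third
strand to be pushed across a minimum and a maximum, by slides and second moves. This covers the classical and the mixed moves at once. A kink
contributes (-a)^3 or (-a)^-3, according to its sign.

The detour move is global and is checked state by state. Classical vertices lie
off the moved strand, hence a choice of smoothings of one diagram is a choice of
smoothings of the other, and the two resulting flat diagrams are again related
by a detour, so that they are equal in the module.

For oriented diagrams, forgetting the orientations turns each move into the
same move of the underlying diagrams. The writhe is unchanged except by the
first move: this is read off the labels of the two strands at each vertex, which
a local move permutes in a controlled way; under a detour the writhe depends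
only on the part of the diagram that stays. The first move changes the writhe by
the sign of the kink, which cancels the factor of the bracket. *)

(** * Heights *)

(** With a single label, the list of the labels at some height is determined by
its length. Counting strands instead turns the side conditions of all moves
into linear arithmetic. *)
Definition hact (n : nat) (e : event unit) : option nat :=
  match e with
  | Min k _ => if (k <= n)%N then Some n.+2 else None
  | Max k => if (k.+2 <= n)%N then Some n.-2 else None
  | Vertex k _ => if (k.+2 <= n)%N then Some n else None
  end.

Fixpoint hrun (n : nat) (w : uword) : option nat :=
  if w is e :: w' then obind (hrun^~ w') (hact n e) else Some n.

Lemma unit_seq (s : seq unit) : s = nseq (size s) tt.
Proof. by elim: s => //= -[] s {1}->. Qed.

Lemma unit_seq_inj : injective (@size unit).
Proof. by move=> s t st; rewrite [s]unit_seq [t]unit_seq st. Qed.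

Lemma act_height n e :
  act id (nseq n tt) e = omap (fun m => nseq m tt) (hact n e).
Proof.
have split_drop k : drop k (nseq n tt) =
    if (k.+2 <= n)%N then [:: tt, tt & nseq (n - k.+2) tt] else nseq (n - k) tt.
  by rewrite drop_nseq; case: ifP => // kn; apply: unit_seq_inj;
    rewrite /= !size_nseq; lia.
case: e => [k []|k|k v] /=; first 1 last.
- rewrite split_drop; case: ifP => /= kn.
    by congr (Some _); apply: unit_seq_inj;
      rewrite size_cat /= ?size_drop size_takel ?size_nseq; lia.
  by case E: (n - k)%N => [|[|m]] //; lia.
- rewrite split_drop; case: ifP => /= kn.
    by congr (Some _); apply: unit_seq_inj;
      rewrite size_cat /= ?size_drop size_takel ?size_nseq; lia.
  by case E: (n - k)%N => [|[|m]] //; lia.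
rewrite size_nseq; case: ifP => //= kn.
by congr (Some _); apply: unit_seq_inj;
  rewrite size_cat /= ?size_drop size_takel ?size_nseq; lia.
Qed.

Lemma run_height n w :
  run id (nseq n tt) w = omap (fun m => nseq m tt) (hrun n w).
Proof.
elim: w n => [//|e w IHw] n /=; rewrite act_height.
by case: (hact n e) => //= m; apply: IHw.
Qed.

Lemma run_size s t (w : uword) :
  run id s w = Some t -> hrun (size s) w = Some (size t).
Proof.
rewrite {1}[s]unit_seq run_height; case: hrun => //= m [<-].
by rewrite size_nseq.
Qed.

Lemma run_closed (w : uword) :
  (run id [::] w == Some [::]) = (hrun 0 w == Some 0).
Proof.
by rewrite -[[::]]/(nseq 0 tt) run_height; case: hrun => [[|m]|].
Qed.

Lemma hrun_cat n u v : hrun n (u ++ v) = obind (hrun^~ v) (hrun n u).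
Proof. by elim: u n => [//|e u IHu] n /=; case: hact. Qed.

Lemma forget_unit (w : uword) : [seq forget_label e | e <- w] = w.
Proof. by rewrite -[RHS]map_id; apply: eq_map => -[k []|k|k v]. Qed.

(** * Classes of words *)

Notation classical := (has (@is_classical unit)).

(** The class of a flat diagram, extended by 0 to the words that are not closed or
not flat. Being total, it can be evaluated at the results of substitutions
without carrying proofs of well-formedness. *)
Definition flat_class (w : uword) : Gf :=
  if insub w is Some D then
    if insub (D : udiagram) is Some F then class_of (gen F) else 0
  else 0.

Lemma flat_classE (F : fdiagram) : flat_class F = class_of (gen F).
Proof. by rewrite /flat_class !valK. Qed.

Definition closed_flat w := (hrun 0 w == Some 0%N) && ~~ classical w.

Lemma flat_class0 w : ~~ closed_flat w -> flat_class w = 0.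
Proof.
rewrite negb_and negbK -run_closed /flat_class.
by case: insubP => [D -> /= wD cw|//]; rewrite insubF //= wD cw.
Qed.

Lemma closed_flatP w : closed_flat w -> exists F : fdiagram, word F = w.
Proof.
case/andP; rewrite -run_closed => wr wf.
by exists (@Fdiagram (Diagram wr) wf).
Qed.

(** The relations of the module that substitute subwords; circle removal has a
coefficient and detours are not local, so they are treated apart. *)
Definition flat_rule u v :=
  [\/ isotopy_rule u v, flat2_rule u v | flat3_rule u v].

Definition delta : laurent := - la ^+ 2 - la ^- 2.

(** A functional on the words put above n strands that satisfies the local
relations of the module between flat words. Allowing n > 0 is what makes this notion stable under
fixing the surroundings of a disc (flat_invariant_ctx). *)
Record flat_invariant (n : nat) (f : uword -> Gf) : Prop := FlatInvariant {
  inv_rule : forall a u v b m m', flat_rule u v -> ~~ classical u ->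
    ~~ classical v -> hrun n a = Some m -> hrun m u = Some m' ->
    hrun m v = Some m' -> f (a ++ u ++ b) = f (a ++ v ++ b);
  inv_circle : forall a b m k, hrun n a = Some m -> (k <= m)%N ->
    f (a ++ [:: Min k tt; Max k] ++ b) = delta *: f (a ++ b) }.

Lemma relator_class x y : relator (x - y) -> class_of x = class_of y.
Proof.
move=> rxy; apply/class_of_eq/asboolP; exists [:: (1, x - y)].
by split=> [p|]; rewrite ?inE ?big_seq1 ?scale1r // => /eqP ->.
Qed.

Lemma flat_class_invariant : flat_invariant 0 flat_class.
Proof.
split=> [a u v b m m' ruv uf vf am um vm|a b m k am km].
  have cuv : closed_flat (a ++ v ++ b) = closed_flat (a ++ u ++ b).
    rewrite /closed_flat !hrun_cat am /= !hrun_cat um vm /=.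
    by rewrite !has_cat (negPf uf) (negPf vf).
  have [cu|nc] := boolP (closed_flat (a ++ u ++ b)); last first.
    by rewrite !flat_class0 ?cuv.
  have cv := cu; rewrite -cuv in cv.
  have [F Fu] := closed_flatP cu; have [G Gv] := closed_flatP cv.
  have FG rule : rule u v -> local_move rule F G.
    exists a, u, v, b, (nseq m tt), (nseq m' tt); rewrite !forget_unit.
    by rewrite -[[::]]/(nseq 0 tt) !run_height am um vm.
  rewrite -Fu -Gv !flat_classE; apply: relator_class.
  by case: ruv => /FG; [exact: Rel_isotopy|exact: Rel_flat2|exact: Rel_flat3].
set w := _ ++ _ ++ _.
have cw : closed_flat w = closed_flat (a ++ b).
  by rewrite /closed_flat !hrun_cat am /= km /= !ltnS km /= !has_cat.
have [cab|nc] := boolP (closed_flat (a ++ b)); last first.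
  by rewrite !flat_class0 ?scaler0 ?cw.
have [F Fu] := closed_flatP cab; rewrite -cw in cab.
have [G Gv] := closed_flatP cab.
rewrite -Fu -Gv !flat_classE -[RHS]class_ofZ; apply: relator_class.
by apply: Rel_circle; exists a, b, k.
Qed.

(** * The state expansion *)

(** The state sum of w, with an arbitrary functional f in place of the class of a
state. Thanks to the continuation, the expansion of a concatenation is an
iterated expansion, without any product of families of states. *)
Fixpoint expand (w : uword) (f : uword -> Gf) : Gf :=
  match w with
  | [::] => f [::]
  | Vertex k (Classical b) :: w' =>
      la *: expand w' (fun x => f (smooth_vertex true k b ++ x))
      + la^-1 *: expand w' (fun x => f (smooth_vertex false k b ++ x))
  | e :: w' => expand w' (fun x => f (e :: x))
  end.

Lemma eq_expand w f g : f =1 g -> expand w f = expand w g.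
Proof.
elim: w f g => [|e w IHw] f g fg /=; first exact: fg.
case: e => [k c|k|k [b| |]]; try by apply: IHw => x; apply: fg.
by congr (_ *: _ + _ *: _); apply: IHw => x; apply: fg.
Qed.

Lemma expand_cat u v f :
  expand (u ++ v) f = expand u (fun x => expand v (fun y => f (x ++ y))).
Proof.
elim: u f => [//|e u IHu] f /=.
case: e => [k c|k|k [b| |]]; rewrite !IHu //.
congr (_ *: _ + _ *: _); apply: eq_expand => x; apply: eq_expand => y.
  by rewrite catA.
by rewrite catA.
Qed.

Lemma expandZ c w f : expand w (fun x => c *: f x) = c *: expand w f.
Proof.
elim: w f => [//|e w IHw] f /=.
case: e => [k c0|k|k [b| |]]; rewrite !IHw //.
by rewrite scalerDr !scalerA ![_ * c]mulrC.
Qed.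

Lemma hrun_smooth A k b n :
  (k.+2 <= n)%N -> hrun n (smooth_vertex A k b) = Some n.
Proof.
rewrite /smooth_vertex; case: ifP => //= _ kn.
by rewrite kn /= ifT; [congr (Some _); lia|lia].
Qed.

(** Smoothing keeps the number of strands, so the states of w have its height. *)
Lemma expand_height w n m f g : hrun n w = Some m ->
  (forall x, hrun n x = Some m -> f x = g x) -> expand w f = expand w g.
Proof.
elim: w n f g => [|e w IHw] n f g /=; first by move=> [<-] ->.
case En: (hact n e) => [p|//] /= wm fg.
have step x : hrun p x = Some m -> f (e :: x) = g (e :: x).
  by move=> xm; apply: fg; rewrite /= En.
case: e En step => [k c|k|k [b| |]] //= En step; try exact: IHw wm step.
move: En; case: ifP => // kn [np]; rewrite -{}np in wm.
by congr (_ *: _ + _ *: _); apply: (IHw _ _ _ wm) => x xm;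
  apply: fg; rewrite hrun_cat hrun_smooth.
Qed.

Lemma expand_classical a k b c f :
  expand (a ++ Vertex k (Classical b) :: c) f =
  la *: expand (a ++ smooth_vertex true k b ++ c) f
  + la^-1 *: expand (a ++ smooth_vertex false k b ++ c) f.
Proof.
have flat A y g : expand (smooth_vertex A k b ++ y) g =
    expand y (fun x => g (smooth_vertex A k b ++ x)).
  by rewrite /smooth_vertex; case: ifP.
elim: a f => [|e a IHa] f /=; first by rewrite !flat.
case: e => [j d|j|j [d| |]]; [exact: IHa|exact: IHa| |exact: IHa|exact: IHa].
rewrite !IHa.
by rewrite !scalerDr !scalerA ![la^-1 * la]mulrC addrACA.
Qed.

Lemma expand_flat w f : ~~ classical w -> expand w f = f w.
Proof.
by elim: w f => [//|e w IHw] f; case: e => [k c|k|k [b| |]] //= cw; rewrite IHw.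
Qed.

(** * Skein equivalence *)

Lemma flat_invariant_ctx n m a b f : hrun m a = Some n ->
  flat_invariant m f -> flat_invariant n (fun x => f (a ++ x ++ b)).
Proof.
move=> an [fr fc].
have assoc c x d : a ++ (c ++ x ++ d) ++ b = (a ++ c) ++ x ++ (d ++ b).
  by rewrite !catA.
split=> [c u v d p q ruv uf vf cp uq vq|c d p k cp kp]; rewrite !assoc.
  by apply: fr ruv uf vf _ uq vq; rewrite hrun_cat an.
by rewrite -(cat0s d) assoc; apply: fc kp; rewrite hrun_cat an.
Qed.

Lemma flat_invariant_expand n w (g : uword -> uword -> Gf) :
  (forall z, flat_invariant n (g z)) ->
  flat_invariant n (fun x => expand w (fun z => g z x)).
Proof.
move=> gP; split=> [a u v b m m' *|a b m k *].
  by apply: eq_expand => z; apply: (inv_rule (gP z)); eassumption.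
rewrite -expandZ; apply: eq_expand => z.
by apply: (inv_circle (gP z)); eassumption.
Qed.

(** Equality of the brackets inside a disc whose lower boundary meets n strands;
the words may contain classical vertices. *)
Definition skein_eq n u v :=
  forall f, flat_invariant n f -> expand u f = expand v f.

Lemma skein_sym n u v : skein_eq n u v -> skein_eq n v u.
Proof. by move=> uv f /uv. Qed.

Lemma skein_trans n v u w : skein_eq n u v -> skein_eq n v w -> skein_eq n u w.
Proof. by move=> uv vw f fP; rewrite uv ?vw. Qed.

(** Summing over the states of the surroundings first leaves, for each of them, a
functional of the states inside the disc that still satisfies the relations.
Kinks contribute the factor c. *)
Lemma expand_ctx c m n a b u v f : hrun m a = Some n ->
  (forall g, flat_invariant n g -> expand u g = c *: expand v g) ->
  flat_invariant m f -> expand (a ++ u ++ b) f = c *: expand (a ++ v ++ b) f.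
Proof.
move=> an uv fP; rewrite !expand_cat -expandZ.
apply: (expand_height an) => x xn; rewrite !expand_cat.
apply: uv (flat_invariant_expand _ _) => z.
exact: flat_invariant_ctx xn fP.
Qed.

Lemma skein_ctx m n a b u v : hrun m a = Some n ->
  skein_eq n u v -> skein_eq m (a ++ u ++ b) (a ++ v ++ b).
Proof.
move=> an uv f fP; rewrite -[RHS]scale1r.
by apply: (expand_ctx _ an _ fP) => g /uv ->; rewrite scale1r.
Qed.

Arguments skein_ctx m {n} a b {u v}.

(** Both vertices are resolved simultaneously: it suffices to compare the two
pairs of smoothings, one vertical and one horizontal. *)
Lemma skein_smooth n a c a' c' k k' b :
  skein_eq n (a ++ c) (a' ++ c') ->
  skein_eq n (a ++ [:: Max k, Min k tt & c]) (a' ++ [:: Max k', Min k' tt & c']) ->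
  skein_eq n (a ++ Vertex k (Classical b) :: c)
             (a' ++ Vertex k' (Classical b) :: c').
Proof.
move=> vert horiz f fP; rewrite !expand_classical /smooth_vertex.
by case: b => /=; rewrite ?vert ?horiz.
Qed.

Lemma skein_rule n u v m : flat_rule u v -> ~~ classical u -> ~~ classical v ->
  hrun n u = Some m -> hrun n v = Some m -> skein_eq n u v.
Proof.
move=> ruv uf vf um vm f fP; rewrite !expand_flat //.
have := inv_rule fP (a := [::]) [::] ruv uf vf erefl um vm.
by rewrite !cats0.
Qed.

Ltac height := rewrite /=; repeat (rewrite ifT /=; last by lia);
  try by congr (Some _); lia.

Lemma skein_isotopy n u v m : isotopy_rule u v -> ~~ classical u ->
  ~~ classical v -> hrun n u = Some m -> hrun n v = Some m -> skein_eq n u v.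
Proof. by move=> uv; apply: skein_rule; apply: Or31. Qed.

Lemma skein_cancel_left n k : (k < n)%N ->
  skein_eq n [:: Min k tt; Max k.+1] [::].
Proof. by move=> kn; apply: (skein_isotopy (Cancel_left k)) => //; height. Qed.

Lemma skein_cancel_right n k : (k < n)%N ->
  skein_eq n [:: Min k.+1 tt; Max k] [::].
Proof. by move=> kn; apply: (skein_isotopy (Cancel_right k)) => //; height. Qed.

(** For a classical vertex, a quarter turn exchanges vertical and horizontal
smoothings. A vertical smoothing on one side is a bare maximum, and the
horizontal one on the other side is the same maximum with a zigzag. *)
Lemma skein_slide_max n k v : (k.+2 < n)%N ->
  skein_eq n [:: Vertex k v; Max k.+1] [:: Vertex k.+1 (quarter v); Max k].
Proof.
move=> kn; case: v => [b| |]; first last.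
- by apply: (skein_isotopy (m := n.-2) (Slide_max k Virtual)) => //; height.
- by apply: (skein_isotopy (m := n.-2) (Slide_max k Flat)) => //; height.
have cut_left : skein_eq n [:: Max k; Min k tt; Max k.+1] [:: Max k].
  apply: (skein_ctx n [:: Max k] [::] (n := n.-2) _ (skein_cancel_left _));
    [height|lia].
have cut_right : skein_eq n [:: Max k.+1; Min k.+1 tt; Max k] [:: Max k.+1].
  apply: (skein_ctx n [:: Max k.+1] [::] (n := n.-2) _ (skein_cancel_right _));
    [height|lia].
move=> f fP; move: (cut_left f fP) (cut_right f fP) => /= cl cr.
by case: b; rewrite /= ?cl ?cr.
Qed.

Lemma skein_slide_min n k v : (k < n)%N ->
  skein_eq n [:: Min k.+1 tt; Vertex k v] [:: Min k tt; Vertex k.+1 (quarter v)].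
Proof.
move=> kn; case: v => [b| |]; first last.
- by apply: (skein_isotopy (m := n.+2) (Slide_min k Virtual)) => //; height.
- by apply: (skein_isotopy (m := n.+2) (Slide_min k Flat)) => //; height.
move=> f fP.
have := skein_ctx n [::] [:: Min k tt] erefl (skein_cancel_right kn) f fP.
have := skein_ctx n [::] [:: Min k.+1 tt] erefl (skein_cancel_left kn) f fP.
by move=> /= cl cr; case: b; rewrite /= ?cl ?cr.
Qed.

Lemma skein_exchange_flat n k m e f :
  ~~ is_classical e -> ~~ is_classical f ->
  (k + legs_in e + m + legs_in f <= n)%N ->
  skein_eq n [:: at_pos (k + legs_in e + m) f; at_pos k e]
             [:: at_pos k e; at_pos (k + legs_out e + m) f].
Proof.
move=> ef ff kn.
apply: (skein_isotopy
  (m := n - legs_in e - legs_in f + legs_out e + legs_out f) (Exchange k m e f)).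
- by case: e f ef ff {kn} => [? ?|?|? [?| |]] [? ?|?|? [?| |]].
- by case: e f ef ff {kn} => [? ?|?|? [?| |]] [? ?|?|? [?| |]].
- by case: e f {ef ff} kn => [? ?|?|? ?] [? ?|?|? ?] kn;
    move: kn; rewrite /= => kn; height.
- by case: e f {ef ff} kn => [? ?|?|? ?] [? ?|?|? ?] kn;
    move: kn; rewrite /= => kn; height.
Qed.

(** The horizontal smoothing of a classical f is a maximum and a minimum, which move past e
one after the other; the vertical one is empty. *)
Lemma skein_exchange_left n k m e f : ~~ is_classical e ->
  (k + legs_in e + m + legs_in f <= n)%N ->
  skein_eq n [:: at_pos (k + legs_in e + m) f; at_pos k e]
             [:: at_pos k e; at_pos (k + legs_out e + m) f].
Proof.
move=> ef kn; case: f kn => [j c|j|j v] kn;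
  try exact: skein_exchange_flat kn.
case: v kn => [b| |] kn; try exact: skein_exchange_flat kn.
move: kn => /= kn; set K := (k + legs_in e + m)%N.
set K' := (k + legs_out e + m)%N.
apply: (skein_smooth (a := [::]) (c := [:: at_pos k e])
  (a' := [:: at_pos k e]) (c' := [::])) => //=.
have min_e : skein_eq n.-2 [:: Min K tt; at_pos k e] [:: at_pos k e; Min K' tt].
  by apply: (skein_exchange_flat (f := Min 0 tt)) => //=; lia.
have max_e : skein_eq n [:: Max K; at_pos k e] [:: at_pos k e; Max K'].
  by apply: (skein_exchange_flat (f := Max 0)) => //=; lia.
apply: (@skein_trans _ [:: Max K; at_pos k e; Min K' tt]).
  by apply: (skein_ctx n [:: Max K] [::] _ min_e); rewrite /K; height.
exact: (skein_ctx n [::] [:: Min K' tt] erefl max_e).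
Qed.

Lemma skein_exchange n k m e f : (k + legs_in e + m + legs_in f <= n)%N ->
  skein_eq n [:: at_pos (k + legs_in e + m) f; at_pos k e]
             [:: at_pos k e; at_pos (k + legs_out e + m) f].
Proof.
have [|ef] := boolP (is_classical e); last exact: skein_exchange_left.
case: e => [//|//|j [b| |]] //= _ kn; set K := (k + 2 + m)%N.
apply: (skein_smooth (a := [:: at_pos K f]) (c := [::])
  (a' := [::]) (c' := [:: at_pos K f])) => //=.
have max_f : skein_eq n [:: at_pos K f; Max k] [:: Max k; at_pos (k + m) f].
  have := @skein_exchange_left n k m (Max k) f.
  by rewrite /= addn0; apply => //; lia.
have min_f : skein_eq n.-2 [:: at_pos (k + m) f; Min k tt] [:: Min k tt; at_pos K f].
  have := @skein_exchange_left n.-2 k m (Min k tt) f.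
  by rewrite /= addn0; apply => //; lia.
apply: (@skein_trans _ [:: Max k; at_pos (k + m) f; Min k tt]).
  exact: (skein_ctx n [::] [:: Min k tt] erefl max_f).
by apply: (skein_ctx n [:: Max k] [::] _ min_f); height.
Qed.

(** * Second moves and kinks *)

(** Of the four states, one is trivial with weight 1. The other three are equal to
the horizontal smoothing up to a circle, with total weight
a^2 + delta + a^-2 = 0: this is what determines the value of a circle. *)
Lemma skein_classical2 n k b : (k.+1 < n)%N ->
  skein_eq n [:: Vertex k (Classical b); Vertex k (Classical (~~ b))] [::].
Proof.
move=> kn f fP.
(* two horizontal smoothings on top of each other enclose a circle *)
have circle : f [:: Max k; Min k tt; Max k; Min k tt] =
    delta *: f [:: Max k; Min k tt].
  by apply: (inv_circle fP (a := [:: Max k]) [:: Min k tt] (m := n.-2));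
    [height|lia].
have cancel : la * la + (la^-1 * la^-1 + delta) = 0.
  by rewrite /delta -exprVn; ring.
case: b; rewrite /= circle !scalerDr !scalerA ?mulrA ?mulVr ?mulrV ?la_unit //
  ?mul1r !scale1r.
- by rewrite addrAC -!scalerDl [delta + _]addrC cancel scale0r add0r.
- by rewrite addrA addrAC -!scalerDl -addrA [delta + _]addrC cancel scale0r add0r.
Qed.

Lemma deltaE : delta = - (la * la) - la^-1 * la^-1.
Proof. by rewrite /delta -exprVn !expr2. Qed.

Definition kink_sign (b : bool) : int := if b then 1 else -1.

(** In the two states of a kink, one has a separate circle and the other is a bare
strand up to zigzags, whence this combination of weights. *)
Lemma kink_factorT : la * delta + la^-1 = (- la) ^ (3 * kink_sign true).
Proof.
rewrite (_ : 3 * kink_sign true = 3%:Z) // -exprnP deltaE.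
have inv3 : la * (la^-1 * la^-1) = la^-1 by rewrite mulrA mulrV ?la_unit ?mul1r.
by rewrite mulrDr !mulrN inv3 addrNK; ring.
Qed.

Lemma kink_factorF : la^-1 * delta + la = (- la) ^ (3 * kink_sign false).
Proof.
rewrite (_ : 3 * kink_sign false = - 3%:Z) // -exprnN -exprVn invrN deltaE.
have inv3 : la^-1 * (la * la) = la by rewrite mulrA mulVr ?la_unit ?mul1r.
by rewrite mulrDr !mulrN inv3 addrC addrA subrr add0r; ring.
Qed.

Lemma expand_kink_right n k b f : (k < n)%N -> flat_invariant n f ->
  expand [:: Min k.+1 tt; Vertex k (Classical b); Max k.+1] f
  = (- la) ^ (3 * kink_sign b) *: expand [::] f.
Proof.
move=> kn fP.
have circle : f [:: Min k.+1 tt; Max k.+1] = delta *: f [::].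
  exact: (inv_circle fP (a := [::]) [::] (m := n)).
have := skein_ctx n [::] [:: Min k tt; Max k.+1] erefl
  (skein_cancel_right kn) f fP.
move: (skein_cancel_left kn fP) => /= -> curl.
case: b; rewrite /= circle curl scalerA -scalerDl ?kink_factorT //.
by rewrite addrC kink_factorF.
Qed.

Lemma expand_kink_left n k b f : (k < n)%N -> flat_invariant n f ->
  expand [:: Min k tt; Vertex k.+1 (Classical b); Max k] f
  = (- la) ^ (3 * kink_sign b) *: expand [::] f.
Proof.
move=> kn fP.
have circle : f [:: Min k tt; Max k] = delta *: f [::].
  by apply: (inv_circle fP (a := [::]) [::] (m := n)); last by lia.
have := skein_ctx n [::] [:: Min k.+1 tt; Max k] erefl
  (skein_cancel_left kn) f fP.
move: (skein_cancel_right kn fP) => /= -> curl.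
case: b; rewrite /= circle curl scalerA -scalerDl ?kink_factorT //.
by rewrite addrC kink_factorF.
Qed.

(** * Third moves *)

(** A strand that crosses another one twice in the manner v can be pulled off.
Flat and classical vertices share this property, so that the third moves can be
proved for both at once. *)
Definition unlinks (v : vertex) : Prop := forall n k, (k.+1 < n)%N ->
  skein_eq n [:: Vertex k v; Vertex k (quarter v)] [::].

Lemma unlinks_classical b : unlinks (Classical b).
Proof. by move=> n k; apply: skein_classical2. Qed.

Lemma unlinks_flat : unlinks Flat.
Proof.
move=> n k kn; apply: (skein_rule (m := n)) => //; last by height.
exact/Or32/Flat2.
Qed.

Lemma quarterK : involutive quarter.
Proof. by case=> // b; rewrite /= negbK. Qed.

Lemma unlinks_quarter v : unlinks v -> unlinks (quarter v).
Proof. by case: v => [b _|vP|vP]; [exact: unlinks_classical|exact: vP|exact: vP]. Qed.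

(** A strand that passes over, under or flatly through both legs of a minimum can
be pulled across it: slide one vertex, then cancel the two. *)
Lemma skein_min_shift_right n k v : unlinks v -> (k < n)%N ->
  skein_eq n [:: Min k tt; Vertex k.+1 v; Vertex k v] [:: Min k.+1 tt].
Proof.
move=> vP kn; have slide := skein_sym (skein_slide_min (quarter v) kn).
have unlink : skein_eq n.+2 [:: Vertex k (quarter v); Vertex k v] [::].
  by have := unlinks_quarter vP; rewrite /unlinks quarterK; apply; lia.
rewrite quarterK in slide.
apply: skein_trans (skein_ctx n [::] [:: Vertex k v] erefl slide) _.
by apply: (skein_ctx n [:: Min k.+1 tt] [::] _ unlink); height.
Qed.

Lemma skein_min_shift_left n k v : unlinks v -> (k < n)%N ->
  skein_eq n [:: Min k.+1 tt; Vertex k v; Vertex k.+1 v] [:: Min k tt].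
Proof.
move=> vP kn; have slide := skein_slide_min v kn.
have unlink : skein_eq n.+2 [:: Vertex k.+1 (quarter v); Vertex k.+1 v] [::].
  by have := unlinks_quarter vP; rewrite /unlinks quarterK; apply; lia.
apply: skein_trans (skein_ctx n [::] [:: Vertex k.+1 v] erefl slide) _.
by apply: (skein_ctx n [:: Min k tt] [::] _ unlink); height.
Qed.

Lemma skein_max_shift_right n k v : unlinks v -> (k.+2 < n)%N ->
  skein_eq n [:: Vertex k v; Vertex k.+1 v; Max k] [:: Max k.+1].
Proof.
move=> vP kn; have slide := skein_sym (skein_slide_max (quarter v) kn).
rewrite quarterK in slide.
have slide' : skein_eq n [:: Vertex k v; Vertex k.+1 v; Max k]
    [:: Vertex k v; Vertex k (quarter v); Max k.+1].
  by apply: (skein_ctx n [:: Vertex k v] [::] _ slide); height.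
apply: skein_trans slide' _.
by apply: (skein_ctx n [::] [:: Max k.+1] erefl (vP n k _)); lia.
Qed.

Lemma skein_max_shift_left n k v : unlinks v -> (k.+2 < n)%N ->
  skein_eq n [:: Vertex k.+1 v; Vertex k v; Max k.+1] [:: Max k].
Proof.
move=> vP kn; have slide := skein_slide_max v kn.
have slide' : skein_eq n [:: Vertex k.+1 v; Vertex k v; Max k.+1]
    [:: Vertex k.+1 v; Vertex k.+1 (quarter v); Max k].
  by apply: (skein_ctx n [:: Vertex k.+1 v] [::] _ slide); height.
apply: skein_trans slide' _.
by apply: (skein_ctx n [::] [:: Max k] erefl (vP n k.+1 _)); lia.
Qed.

(** The third strand meets the first two in the same way, so it can be pushed
across both smoothings of the vertex of these two. *)
Lemma skein_triangle12 n k v b : unlinks v -> (k.+2 < n)%N ->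
  skein_eq n (triangle_up k (Classical b) v v) (triangle_down k (Classical b) v v).
Proof.
move=> vP kn; apply: (skein_smooth (a := [::]) (c := [:: Vertex k.+1 v; Vertex k v])
  (a' := [:: Vertex k.+1 v; Vertex k v]) (c' := [::])) => //=.
have up : skein_eq n [:: Max k; Min k tt; Vertex k.+1 v; Vertex k v]
    [:: Max k; Min k.+1 tt].
  have through : skein_eq n.-2 [:: Min k tt; Vertex k.+1 v; Vertex k v]
      [:: Min k.+1 tt] by apply: (skein_min_shift_right vP); lia.
  by apply: (skein_ctx n [:: Max k] [::] _ through); height.
apply: skein_trans up (skein_sym _).
exact: (skein_ctx n [::] [:: Min k.+1 tt] erefl (skein_max_shift_left vP kn)).
Qed.

(** Mirror image of skein_triangle12: here the first strand is pushed across. *)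
Lemma skein_triangle23 n k v b : unlinks v -> (k.+2 < n)%N ->
  skein_eq n (triangle_up k v v (Classical b)) (triangle_down k v v (Classical b)).
Proof.
move=> vP kn; apply: (skein_smooth (a := [:: Vertex k v; Vertex k.+1 v]) (c := [::])
  (a' := [::]) (c' := [:: Vertex k v; Vertex k.+1 v])) => //=.
have down : skein_eq n [:: Max k.+1; Min k.+1 tt; Vertex k v; Vertex k.+1 v]
    [:: Max k.+1; Min k tt].
  have through : skein_eq n.-2 [:: Min k.+1 tt; Vertex k v; Vertex k.+1 v]
      [:: Min k tt] by apply: (skein_min_shift_left vP); lia.
  by apply: (skein_ctx n [:: Max k.+1] [::] _ through); height.
apply: skein_trans _ (skein_sym down).
exact: (skein_ctx n [::] [:: Min k tt] erefl (skein_max_shift_right vP kn)).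
Qed.

(** When the second strand is the moving one, it slides across the maximum and the
minimum of the horizontal smoothing; for the vertical one, it can be pulled off
on either side of the triangle. *)
Lemma skein_triangle13 n k b : (k.+2 < n)%N ->
  skein_eq n (triangle_up k Flat (Classical b) Flat)
             (triangle_down k Flat (Classical b) Flat).
Proof.
move=> kn; apply: (skein_smooth (a := [:: Vertex k Flat]) (c := [:: Vertex k Flat])
  (a' := [:: Vertex k.+1 Flat]) (c' := [:: Vertex k.+1 Flat])) => /=.
  apply: (@skein_trans _ [::]); first by apply: unlinks_flat; lia.
  by apply: skein_sym; apply: unlinks_flat; lia.
have slide_min : skein_eq n.-2 [:: Min k.+1 tt; Vertex k Flat]
    [:: Min k tt; Vertex k.+1 Flat] by apply: skein_slide_min; lia.
apply: skein_trans (skein_ctx n [::] [:: Min k.+1 tt; Vertex k Flat] erefl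
  (skein_slide_max Flat kn)) _.
by apply: (skein_ctx n [:: Vertex k.+1 Flat; Max k] [::] _ slide_min); height.
Qed.

(** * The bracket is a sum of local contributions *)

Definition invariant_rule (rule : uword -> uword -> Prop) : Prop :=
  forall n m u v, rule u v -> hrun n u = Some m -> hrun n v = Some m ->
  skein_eq n u v.

Lemma isotopy_invariant : invariant_rule isotopy_rule.
Proof.
move=> n m _ _ [k j e f|k|k|k v|k v] um _.
- apply: skein_exchange; move: um.
  by case: f e => [? ?|?|? ?] [? ?|?|? ?] /=; case: ifP => //= + _; lia.
- by apply: skein_cancel_left; move: um => /=; case: ifP => //= _; case: ifP.
- by apply: skein_cancel_right; move: um => /=; case: ifP.
- apply: skein_slide_max; move: um => /=.
  by case: ifP => //= _; case: ifP.
- by apply: skein_slide_min; move: um => /=; case: ifP.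
Qed.

Lemma classical2_invariant : invariant_rule classical2_rule.
Proof.
move=> n m _ _ [k b] um _; apply: skein_classical2.
by move: um => /=; case: ifP.
Qed.

Lemma flat2_invariant : invariant_rule flat2_rule.
Proof.
move=> n m _ _ [k] um _; apply: unlinks_flat.
by move: um => /=; case: ifP.
Qed.

Lemma flat3_invariant : invariant_rule flat3_rule.
Proof.
by move=> n m u v uv um vm; case: (uv) um vm => k um vm; apply: skein_rule um vm;
  rewrite //; exact/Or33/Flat3.
Qed.

Lemma triangle_height n m k v12 v13 v23 :
  hrun n (triangle_up k v12 v13 v23) = Some m -> (k.+2 < n)%N.
Proof. by move=> /=; case: ifP => //= _; case: ifP. Qed.

(** Without cyclic order, one of the outer strands lies over or under both others:
the third one if b13 = b23, the first one if b12 = b13. *)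
Lemma classical3_invariant : invariant_rule classical3_rule.
Proof.
move=> n m _ _ [k b12 b13 b23 acyclic] /triangle_height kn _.
have [->|b12_13] := eqVneq b13 b23.
  by apply: skein_triangle12 kn; apply: unlinks_classical.
suff -> : b13 = b12 by apply: skein_triangle23 kn; apply: unlinks_classical.
by case: b12 b13 b23 acyclic b12_13 => -[] [].
Qed.

Lemma mixed3_invariant : invariant_rule mixed3_rule.
Proof.
move=> n m _ _ [k b|k b|k b] /triangle_height kn _.
- by apply: skein_triangle12 kn; apply: unlinks_flat.
- exact: skein_triangle13 kn.
- by apply: skein_triangle23 kn; apply: unlinks_flat.
Qed.

Lemma sum_tuple_cons n (F : seq bool -> Gf) :
  \sum_(s : n.+1.-tuple bool) F s =
  \sum_(s : n.-tuple bool) F (true :: s) + \sum_(s : n.-tuple bool) F (false :: s).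
Proof.
pose cons_t (p : bool * n.-tuple bool) : n.+1.-tuple bool := [tuple of p.1 :: p.2].
rewrite (reindex cons_t) /=.
  rewrite -(pair_bigA _ (fun b (s : n.-tuple bool) => F (b :: s))) /=.
  by rewrite big_bool.
exists (fun s => (thead s, [tuple of behead s])) => [[b s] _|s _].
  by congr (_, _); apply: val_inj.
by case/tupleP: s => b s; apply: val_inj.
Qed.

Lemma state_sum w (f : uword -> Gf) :
  \sum_(s : (count (@is_classical unit) w).-tuple bool)
    la ^ ((count_mem true s)%:Z - (count_mem false s)%:Z) *: f (smooth_word s w)
  = expand w f.
Proof.
have sum0 (F : seq bool -> Gf) : \sum_(s : 0.-tuple bool) F s = F [::].
  by rewrite (big_pred1 [tuple]) // => s; apply/esym/eqP; apply: tuple0.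
have laS m : la * la ^ m = la ^ (1 + m) by rewrite exprzDr ?la_unit ?expr1z.
have laB m : la^-1 * la ^ m = la ^ (-1 + m) by rewrite exprzDr ?la_unit ?exprN1.
pose term w (g : uword -> Gf) (s : seq bool) :=
  la ^ ((count_mem true s)%:Z - (count_mem false s)%:Z) *: g (smooth_word s w).
elim: w f => [|e w IHw] f.
  by rewrite (sum0 (term [::] f)) /term subrr expr0z scale1r.
case: e => [k c|k|k [b| |]]; try exact: (IHw (fun x => f (_ :: x))).
rewrite (sum_tuple_cons _ (term (Vertex k (Classical b) :: w) f)) /term /=.
rewrite -!IHw !scaler_sumr; congr (_ + _); apply: eq_bigr => s _.
  by rewrite scalerA laS add0n PoszD addrA.
by rewrite scalerA laB add0n PoszD opprD addrCA.
Qed.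

Lemma bracket_expand K : bracket K = expand K flat_class.
Proof.
by rewrite -state_sum; apply: eq_bigr => s _; rewrite -flat_classE.
Qed.

Lemma bracket_local c (K K' : udiagram) n p u v q :
  word K = p ++ u ++ q -> word K' = p ++ v ++ q -> hrun 0 p = Some n ->
  (forall f, flat_invariant n f -> expand u f = c *: expand v f) ->
  bracket K = c *: bracket K'.
Proof.
move=> KE KE' pn uv; rewrite !bracket_expand KE KE'.
exact: (expand_ctx _ pn uv flat_class_invariant).
Qed.

Lemma bracket_invariant_rule rule (K K' : udiagram) :
  invariant_rule rule -> local_move rule K K' -> bracket K = bracket K'.
Proof.
move=> ruleP [p [u [v [q [s [t [KE KE' [uv prun urun vrun]]]]]]]].
rewrite -[RHS]scale1r; apply: bracket_local KE KE' (run_size prun) _ => f fP.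
rewrite scale1r; rewrite !forget_unit in uv.
exact: (ruleP _ _ _ _ uv (run_size urun) (run_size vrun) f fP).
Qed.

(** * Detours *)

Notation coloured_word := (seq (event (bool * unit) + nat)).
Notation part_word := (seq (event unit + bool * nat * unit)).

(** Smoothing a coloured diagram. Classical vertices are off the coloured strand, so
the new extrema are uncoloured. *)
Fixpoint csmooth (s : seq bool) (R : coloured_word) : coloured_word :=
  match R with
  | [::] => [::]
  | inl (Vertex k (Classical b)) :: R' =>
      (if head true s == b then [::] else [:: inl (Max k); inl (Min k (false, tt))])
      ++ csmooth (behead s) R'
  | x :: R' => x :: csmooth s R'
  end.

(** Smoothing the uncoloured part alone, which is all that two diagrams related by
a detour have in common. *)
Fixpoint psmooth (s : seq bool) (P : part_word) : part_word :=
  match P with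
  | [::] => [::]
  | inl (Vertex k (Classical b)) :: P' =>
      (if head true s == b then [::] else [:: inl (Max k); inl (Min k tt)])
      ++ psmooth (behead s) P'
  | x :: P' => x :: psmooth s P'
  end.

Lemma uncolour_csmooth s (R : coloured_word) :
  flatten [seq uncolour x | x <- csmooth s R] =
  smooth_word s (flatten [seq uncolour x | x <- R]).
Proof.
elim: R s => [//|x R IHR] s.
case: x => [[k [c []]|k|k [b| |]]|k] /=; rewrite -?IHR //.
by rewrite map_cat flatten_cat; congr (_ ++ _); rewrite /smooth_vertex; case: ifP.
Qed.

Lemma drop_consP (T : Type) k (s : seq T) x r :
  drop k s = x :: r -> exists2 p, size p = k & s = p ++ x :: r.
Proof.
move=> sk; exists (take k s); last by rewrite -sk cat_take_drop.
rewrite size_takel // leqNgt; apply/negP => /ltnW /drop_oversize.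
by rewrite sk.
Qed.

(** With trivial labels, a classical vertex exchanges two identical strands. *)
Lemma cact_classical (t t' : seq (bool * unit)) k b :
  cact id t (inl (Vertex k (Classical b))) = Some t' ->
  t' = t /\ exists p r, size p = k /\ t = p ++ [:: (false, tt), (false, tt) & r].
Proof.
rewrite /=; case Ed: (drop k t) => [|[c []] [|[d []] r]] //=; try by case: ifP.
rewrite take0 /= orbF; have [p pk ->] := drop_consP Ed.
case: c d {Ed} => [] [] //= [<-]; rewrite take_size_cat //; split=> //.
by exists p, r.
Qed.

Lemma crun_cons (L : choiceType) (op : L -> L) t t' x R :
  cact op t x = Some t' -> crun op t (x :: R) = crun op t' R.
Proof. by rewrite [crun _ _ _]/= => ->. Qed.

Lemma part_cons (L : choiceType) (op : L -> L) c t t' x R :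
  cact op t x = Some t' ->
  part op c t (x :: R) = part_event c t x ++ part op c t' R.
Proof. by rewrite [part _ _ _ _]/= => ->. Qed.

(** The coloured strand is untouched by the smoothings, and they commute with
taking the uncoloured part. *)
Lemma csmoothP s (t : seq (bool * unit)) (R : coloured_word) :
  crun id t R != None ->
  [/\ crun id t (csmooth s R) = crun id t R,
      part id true t (csmooth s R) = part id true t R &
      part id false t (csmooth s R) = psmooth s (part id false t R)].
Proof.
elim: R s t => [//|x R IHR] s t.
case tx: (cact id t x) => [t'|]; last by rewrite /= tx.
rewrite (crun_cons _ tx) => R_def.
have [[k [b Dx]]|[csx psx]] : (exists k b, x = inl (Vertex k (Classical b))) \/
    csmooth s (x :: R) = x :: csmooth s R /\
    forall P, psmooth s (part_event false t x ++ P) =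
              part_event false t x ++ psmooth s P.
- case: x {tx} => [[k [[] c]|k|k [b| |]]|k]; try by [left; exists k, b];
    by right; split=> // P; rewrite /=; try case: ifP => //; case: drop.
- rewrite {x}Dx in tx *; have [t't [p [r [pk Dt]]]] := cact_classical tx.
  have drop_t : drop k t = [:: (false, tt), (false, tt) & r].
    by rewrite Dt drop_size_cat.
  have take_t : take k t = p by rewrite Dt take_size_cat.
  rewrite !(part_cons _ _ tx) {}t't in R_def *.
  have [IH1 IH2 IH3] := IHR (behead s) t R_def.
  have Max_t : cact id t (inl (Max k)) = Some (p ++ r) by rewrite /= drop_t take_t.
  have Min_t : cact id (p ++ r) (inl (Min k (false, tt))) = Some t.
    by rewrite /= size_cat pk leq_addr take_size_cat // drop_size_cat // Dt.
  pose pos := count (fun c : bool * unit => c.1 == false) p.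
  have V_event c : part_event c t (inl (Vertex k (Classical b))) =
      if c then [::] else [:: inl (Vertex pos (Classical b))].
    by rewrite /= drop_t take_t; case: c; rewrite //= take0.
  have M_event c : part_event c t (inl (Max k)) =
      if c then [::] else [:: inl (Max pos)].
    by rewrite /= drop_t take_t; case: c; rewrite //= take0.
  have m_event c : part_event c (p ++ r) (inl (Min k (false, tt))) =
      if c then [::] else [:: inl (Min pos tt)].
    by rewrite /= take_size_cat //; case: c.
  rewrite !V_event [csmooth _ _]/= [psmooth _ _]/=.
  case: ifP => _; first by split.
  rewrite !cat_cons !cat0s.
  rewrite (crun_cons _ Max_t) (crun_cons _ Min_t).
  rewrite !(part_cons _ _ Max_t) !(part_cons _ _ Min_t) !M_event !m_event.
  by rewrite /= IH2 IH3.
have [IH1 IH2 IH3] := IHR s t' R_def.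
by rewrite csx (crun_cons _ tx) !(part_cons _ _ tx) psx IH1 IH2 IH3.
Qed.

Lemma count_classical_part (t : seq (bool * unit)) (R : coloured_word) :
  crun id t R != None ->
  count (@is_classical unit) (flatten [seq uncolour x | x <- R]) =
  count (fun x => if x is inl e then is_classical e else false)
        (part id false t R).
Proof.
elim: R t => [//|x R IHR] t.
case tx: (cact id t x) => [t'|]; last by rewrite /= tx.
rewrite (crun_cons _ tx) => R_def.
rewrite (part_cons _ _ tx) /= !count_cat (IHR _ R_def); congr (_ + _)%N.
case: x tx {R_def} => [[k [[] c]|k|k [b| |]]|k] //.
- by move=> _ /=; case: ifP.
- move=> /cact_classical[_ [p [r [pk ->]]]].
  by rewrite /= drop_size_cat //= take0.
- by move=> _ /=; case: ifP.
- by move=> _ /=; case: ifP.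
- by move=> _ /=; case: drop.
Qed.

Lemma marks_smooth s (D D' : udiagram) R :
  marks_strand D R -> smooth_word s D = D' -> marks_strand D' (csmooth s R).
Proof.
case=> Rrun RD Rarc DD'; have R_def : crun id [::] R != None by rewrite Rrun.
have [run' part' _] := csmoothP s R_def.
by split; rewrite ?run' ?part' ?uncolour_csmooth ?RD.
Qed.

(** The vertices to be smoothed all belong to the common part, so the states of the
two diagrams correspond to each other, and each pair is related by a detour. *)
Lemma bracket_detour (D D' : udiagram) : detour D D' -> bracket D = bracket D'.
Proof.
move=> [R [R' [DR DR' parts]]].
have [Rrun RD _] := DR; have [Rrun' RD' _] := DR'.
have R_def : crun id [::] R != None by rewrite Rrun.
have R_def' : crun id [::] R' != None by rewrite Rrun'.
rewrite /bracket.
have -> : count (@is_classical unit) D = count (@is_classical unit) D'.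
  by rewrite -RD -RD' (count_classical_part R_def)
    (count_classical_part R_def') parts.
apply: eq_bigr => s _; congr (_ *: _); apply: relator_class; apply: Rel_detour.
exists (csmooth s R), (csmooth s R'); split;
  [exact: marks_smooth DR _|exact: marks_smooth DR' _|].
by have [_ _ ->] := csmoothP s R_def; have [_ _ ->] := csmoothP s R_def';
  rewrite parts.
Qed.

Lemma bracket_invariant m (K K' : udiagram) :
  m <> ClassicalR1 -> related_by m K K' -> bracket K = bracket K'.
Proof.
case: m => // _.
- exact: bracket_invariant_rule isotopy_invariant.
- exact: bracket_invariant_rule classical2_invariant.
- exact: bracket_invariant_rule classical3_invariant.
- exact: bracket_invariant_rule flat2_invariant.
- exact: bracket_invariant_rule flat3_invariant.
- exact: bracket_invariant_rule mixed3_invariant.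
- exact: bracket_detour.
Qed.

(** * Forgetting orientations *)

Lemma local_move_underlying rule (D D' : odiagram) :
  local_move rule D D' -> local_move rule (underlying D) (underlying D').
Proof.
case=> pre [u [v [post [s [t [DE DE' [uv prun urun vrun]]]]]]].
pose fl := map (@forget_label bool).
exists (fl pre), (fl u), (fl v), (fl post), [seq tt | _ <- s], [seq tt | _ <- t].
split; rewrite /= ?DE ?DE' /fl ?map_cat //.
rewrite !forget_unit; split=> //.
- exact: run_forget prun.
- exact: run_forget urun.
- exact: run_forget vrun.
Qed.

Section ForgetDetour.
Variables (L : choiceType) (op : L -> L).

Definition cforget_label (c : bool * L) : bool * unit := (c.1, tt).

Definition cforget (x : event (bool * L) + nat) : event (bool * unit) + nat :=
  match x with
  | inl (Min k c) => inl (Min k (cforget_label c))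
  | inl (Max k) => inl (Max k)
  | inl (Vertex k v) => inl (Vertex k v)
  | inr k => inr k
  end.

Definition pforget (x : event L + bool * nat * L) : event unit + bool * nat * unit :=
  match x with
  | inl e => inl (forget_label e)
  | inr (up, k, _) => inr (up, k, tt)
  end.

Notation fc := (map cforget_label).

Lemma cact_forget t t' x : cact op t x = Some t' ->
  cact id (fc t) (cforget x) = Some (fc t').
Proof.
have has_fc s : has fst (fc s) = has fst s by rewrite has_map.
case: x => [[k c|k|k v]|k] /=; rewrite ?size_map -?map_drop -?map_take.
- by case: ifP => // _ [<-]; rewrite map_cat.
- case: drop => [|[c l] [|[d l'] r]] //=; case: ifP => // /eqP[-> _] [<-].
  by rewrite eqxx map_cat.
- rewrite has_fc; case: ifP => // _.
  by case: drop => [|c [|d r]] //= [<-]; rewrite map_cat.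
- by case: drop => [|c r] //= [<-]; rewrite map_cat.
Qed.

Lemma part_event_forget b t x :
  part_event b (fc t) (cforget x) = [seq pforget y | y <- part_event b t x].
Proof.
have count_fc s : count (fun c : bool * unit => c.1 == b) (fc s) =
    count (fun c : bool * L => c.1 == b) s by rewrite count_map.
have all_fc s : all (fun c : bool * unit => c.1 == b) (fc s) =
    all (fun c : bool * L => c.1 == b) s by rewrite all_map.
case: x => [[k c|k|k v]|k] /=; rewrite -?map_drop -!map_take ?count_fc ?all_fc.
- by case: ifP.
- by case: ifP.
- by case: ifP.
- by case: drop.
Qed.

Lemma crun_forget t t' R : crun op t R = Some t' ->
  crun id (fc t) (map cforget R) = Some (fc t') /\
  forall b, part id b (fc t) (map cforget R) = map pforget (part op b t R).
Proof.
elim: R t => [|x R IHR] t; first by move=> [<-].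
case tx: (cact op t x) => [t''|]; last by rewrite /= tx.
rewrite (crun_cons _ tx) [map _ _]/= (crun_cons _ (cact_forget tx)).
case/IHR => -> parts; split=> // b.
by rewrite (part_cons _ _ tx) (part_cons _ _ (cact_forget tx)) part_event_forget
  parts map_cat.
Qed.

Lemma single_arc_forget P : single_arc (map pforget P) = single_arc P.
Proof.
rewrite /single_arc count_map; congr ((_ == 2%N) && _).
  by apply: eq_count => -[e|[[up k] c]].
elim: P 0%N [::] => [//|x P IHP] n s.
by case: x => [[k c|k|k v]|[[[] k] c]] /=; rewrite ?IHP //;
  case: drop => [|i [|j r]] //; rewrite IHP.
Qed.

End ForgetDetour.

Lemma marks_strand_underlying (D : odiagram) R :
  marks_strand D R -> marks_strand (underlying D) (map (@cforget bool) R).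
Proof.
case=> Rrun RD Rarc; have [run' parts] := crun_forget Rrun.
split; rewrite ?run' ?parts ?single_arc_forget // -[RHS]/(map _ (word D)) -RD.
rewrite map_flatten -!map_comp; congr flatten; apply: eq_map.
by case=> [[k c|k|k v]|k].
Qed.

Lemma detour_underlying (D D' : odiagram) :
  detour D D' -> detour (underlying D) (underlying D').
Proof.
move=> [R [R' [DR DR' parts]]];
exists (map (@cforget bool) R), (map (@cforget bool) R').
split; try exact: marks_strand_underlying.
have [/crun_forget[_ parts_R] _ _] := DR; have [/crun_forget[_ parts_R'] _ _] := DR'.
by move: (parts_R false) (parts_R' false) => /= -> ->; rewrite parts.
Qed.

(** * The writhe *)

Definition level (e : event unit) : nat :=
  match e with Min k _ => k | Max k => k | Vertex k _ => k end.

Lemma forget_Min (e : event bool) k : forget_label e = Min k tt ->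
  exists c, e = Min k c.
Proof. by case: e => // j c [->]; exists c. Qed.

Lemma forget_Max (e : event bool) k : forget_label e = Max k -> e = Max k.
Proof. by case: e => // j [->]. Qed.

Lemma forget_Vertex (e : event bool) k v :
  forget_label e = Vertex k v -> e = Vertex k v.
Proof. by case: e => // j w [-> ->]. Qed.

Notation lab := (nth true).

Lemma act_below s e s' i : act negb s e = Some s' ->
  (i < level (forget_label e))%N -> lab s' i = lab s i.
Proof.
case: e => [k c|k|k v] /=.
- case: ifP => // ks [<-] ik; rewrite nth_cat size_takel // ik nth_take //.
- case Es: drop => [|c [|d r]] //=; case: ifP => // _ [<-].
  have [p <- ->] := drop_consP Es; rewrite take_size_cat // => ik.
  by rewrite !nth_cat ik.
- case Es: drop => [|c [|d r]] //= [<-].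
  have [p <- ->] := drop_consP Es; rewrite take_size_cat // => ik.
  by rewrite !nth_cat ik.
Qed.

(** Events shift the strands on their right by the difference of their numbers of
legs and keep their labels. *)
Lemma act_above s e s' i : act negb s e = Some s' ->
  lab s' (level (forget_label e) + legs_out (forget_label e) + i)%N =
  lab s (level (forget_label e) + legs_in (forget_label e) + i)%N.
Proof.
have skip (p q : seq bool) j : lab (p ++ q) (size p + j) = lab q j.
  by rewrite nth_cat ltnNge leq_addr addKn.
case: e => [k c|k|k v] /=.
- case: ifP => // ks [<-]; rewrite -addnA nth_cat size_takel //.
  by rewrite ltnNge leq_addr addKn addn0 /= nth_drop.
- case Es: drop => [|c [|d r]] //=; case: ifP => // _ [<-].
  have [p <- ->] := drop_consP Es; rewrite take_size_cat //.
  by rewrite addn0 -addnA !skip.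
- case Es: drop => [|c [|d r]] //= [<-].
  have [p <- ->] := drop_consP Es; rewrite take_size_cat //.
  by rewrite -addnA !skip.
Qed.

Lemma act_Min s k c s' : act negb s (Min k c) = Some s' ->
  lab s' k = c /\ lab s' k.+1 = ~~ c.
Proof.
rewrite /=; case: ifP => // ks [<-].
by rewrite !nth_cat !size_takel // ltnn ltnNge leqnSn subnn subSnn.
Qed.

Lemma act_Max s k s' : act negb s (Max k) = Some s' -> lab s k.+1 = ~~ lab s k.
Proof.
rewrite /=; case Es: drop => [|c [|d r]] //=; case: eqP Es => // -> Es _.
have [p <- ->] := drop_consP Es.
by rewrite !nth_cat ltnn ltnNge leqnSn subnn subSnn.
Qed.

Lemma act_Vertex s k v s' : act negb s (Vertex k v) = Some s' ->
  lab s' k = lab s k.+1 /\ lab s' k.+1 = lab s k.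
Proof.
rewrite /=; case Es: drop => [|c [|d r]] //= [<-].
have [p <- ->] := drop_consP Es; rewrite take_size_cat //.
by rewrite !nth_cat ltnn ltnNge leqnSn subnn subSnn.
Qed.

Lemma run_consP s t e w : run negb s (e :: w) = Some t ->
  exists2 s', act negb s e = Some s' & run negb s' w = Some t.
Proof. by move=> /=; case: (act negb s e) => //= s'; exists s'. Qed.

Lemma word_writhe_cons s s' e w : act negb s e = Some s' ->
  word_writhe s (e :: w) = vertex_sign s e + word_writhe s' w.
Proof. by rewrite [word_writhe _ _]/= => ->. Qed.

Lemma word_writhe_cat s t u v : run negb s u = Some t ->
  word_writhe s (u ++ v) = word_writhe s u + word_writhe t v.
Proof.
elim: u s => [|e u IHu] s /=; first by move=> [<-]; rewrite add0r.
by case: (act negb s e) => //= s' /IHu ->; rewrite addrA.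
Qed.

Lemma word_writhe_flat s u :
  ~~ classical (map (@forget_label bool) u) -> word_writhe s u = 0.
Proof.
elim: u s => [//|e u IHu] s /= /norP[ne nu].
have -> : vertex_sign s e = 0 by case: e ne => // k [].
by rewrite add0r; case: (act negb s e) => // s'; rewrite IHu.
Qed.

(** The sign of a vertex between strands labelled x and y below it. Flat and
virtual vertices are included so that slides need no case distinction. *)
Definition crossing_sign (v : vertex) (x y : bool) : int :=
  if v is Classical b then (if b == (x == y) then 1 else -1) else 0.

Lemma vertex_signE s k v :
  vertex_sign s (Vertex k v) = crossing_sign v (lab s k) (lab s k.+1).
Proof. by case: v. Qed.

Lemma crossing_signC v x y : crossing_sign v x y = crossing_sign v y x.
Proof. by case: v x y => [[]||] [] []. Qed.

Lemma crossing_signN v x y : crossing_sign v x (~~ y) = - crossing_sign v x y.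
Proof. by case: v x y => [[]||] [] []. Qed.

Lemma crossing_sign_quarter v x y :
  crossing_sign (quarter v) x y = - crossing_sign v x y.
Proof. by case: v x y => [[]||] [] []. Qed.

Notation forget := (map (@forget_label bool)).

Definition writhe_rule (rule : uword -> uword -> Prop) : Prop :=
  forall U V u v s t, rule U V -> forget u = U -> forget v = V ->
  run negb s u = Some t -> run negb s v = Some t ->
  word_writhe s u = word_writhe s v.

(** Each of the two events sees the same labels before and after the other one. *)
Lemma exchange_writhe k m e f u v s t :
  forget u = [:: at_pos (k + legs_in e + m) f; at_pos k e] ->
  forget v = [:: at_pos k e; at_pos (k + legs_out e + m) f] ->
  run negb s u = Some t -> run negb s v = Some t ->
  word_writhe s u = word_writhe s v.
Proof.
case: u => [|f1 [|e1 [|? ?]]] //= -[f1E e1E].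
case: v => [|e2 [|f2 [|? ?]]] //= -[e2E f2E].
case f1s: (act negb s f1) => [s1|//] /=; case e1s: (act negb s1 e1) => [t1|//] _.
case e2s: (act negb s e2) => [s2|//] /=; case f2s: (act negb s2 f2) => [t2|//] _.
have -> : vertex_sign s1 e1 = vertex_sign s e2.
  case: e e1E e2E f1E f2E => [? []|?|? w] e1E e2E f1E f2E.
  - by have [? ->] := forget_Min e1E; have [? ->] := forget_Min e2E.
  - by rewrite (forget_Max e1E) (forget_Max e2E).
  rewrite (forget_Vertex e1E) (forget_Vertex e2E) [legs_in _]/= in f1E *.
  rewrite !vertex_signE.
  have below i : (i < 2)%N -> lab s1 (k + i)%N = lab s (k + i)%N.
    move=> i2; apply: (act_below f1s); rewrite f1E.
    by case: f {f1E f2E} => /= *; lia.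
  by have := below 0%N isT; have := below 1%N isT; rewrite addn0 addn1 => -> ->.
have -> : vertex_sign s f1 = vertex_sign s2 f2.
  case: f f1E f2E => [? []|?|? w] f1E f2E.
  - by have [? ->] := forget_Min f1E; have [? ->] := forget_Min f2E.
  - by rewrite (forget_Max f1E) (forget_Max f2E).
  rewrite (forget_Vertex f1E) (forget_Vertex f2E) !vertex_signE -!addnS.
  have above i : lab s2 (k + legs_out e + i)%N = lab s (k + legs_in e + i)%N.
    by have := act_above i e2s; rewrite e2E; case: (e).
  by rewrite !above.
by rewrite !addr0 addrC.
Qed.

(** The quarter turn and the reversal of one of the two labels at the vertex, as
its strand turns around at the maximum, each change the sign. *)
Lemma slide_max_writhe s t t' k v :
  run negb s [:: Vertex k v; Max k.+1] = Some t ->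
  run negb s [:: Vertex k.+1 (quarter v); Max k] = Some t' ->
  word_writhe s [:: Vertex k v; Max k.+1] =
  word_writhe s [:: Vertex k.+1 (quarter v); Max k].
Proof.
move=> /run_consP[s1 sV /run_consP[s2 sM _]].
move=> /run_consP[s1' sV' /run_consP[s2' sM' _]].
rewrite (word_writhe_cons _ sV) (word_writhe_cons _ sM).
rewrite (word_writhe_cons _ sV') (word_writhe_cons _ sM') !vertex_signE /= !addr0.
have [_ s1k] := act_Vertex sV; have := act_above 0 sV; have := act_Max sM.
rewrite /= addn0 addn2 s1k => -> <-.
by rewrite crossing_sign_quarter crossing_signN opprK crossing_signC.
Qed.

Lemma slide_min_writhe s t k v c c' :
  run negb s [:: Min k.+1 c; Vertex k v] = Some t ->
  run negb s [:: Min k c'; Vertex k.+1 (quarter v)] = Some t ->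
  word_writhe s [:: Min k.+1 c; Vertex k v] =
  word_writhe s [:: Min k c'; Vertex k.+1 (quarter v)].
Proof.
move=> /run_consP[s1 sM /run_consP[t1 sV [t1t]]].
move=> /run_consP[s2 sM' /run_consP[t2 sV' [t2t]]]; subst t1 t2.
rewrite (word_writhe_cons _ sM) (word_writhe_cons _ sM') (word_writhe_cons _ sV)
  (word_writhe_cons _ sV') !vertex_signE /= !addr0 !add0r.
have [s1k1 _] := act_Min sM; have [s2k s2k1] := act_Min sM'.
have [tk _] := act_Vertex sV.
(* the labels above the vertices agree, which identifies the labels of the two minima *)
have tk' := act_below (i := k) sV' (ltnSn k).
have s1k := act_below (i := k) sM (ltnSn k).
have := act_above 0 sM'; rewrite /= addn2 !addn0 => s2k2.
rewrite s1k1 s1k s2k1 s2k2 -s2k -tk' tk s1k1.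
by rewrite crossing_sign_quarter [in RHS]crossing_signC crossing_signN opprK.
Qed.

Lemma isotopy_writhe : writhe_rule isotopy_rule.
Proof.
move=> U V u v s t [k m e f|k|k|k w|k w]; first exact: exchange_writhe.
- by move=> uU vV _ _; rewrite !word_writhe_flat ?uU ?vV.
- by move=> uU vV _ _; rewrite !word_writhe_flat ?uU ?vV.
- case: u => [|e1 [|e2 [|? ?]]] // -[/forget_Vertex -> /forget_Max ->].
  case: v => [|e3 [|e4 [|? ?]]] // -[/forget_Vertex -> /forget_Max ->].
  exact: slide_max_writhe.
case: u => [|e1 [|e2 [|? ?]]] // -[/forget_Min[c ->] /forget_Vertex ->].
case: v => [|e3 [|e4 [|? ?]]] // -[/forget_Min[c' ->] /forget_Vertex ->].
exact: slide_min_writhe.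
Qed.

Lemma flat2_writhe : writhe_rule flat2_rule.
Proof.
move=> U V u v s t [k] uU vV _ _.
by rewrite !word_writhe_flat ?uU ?vV.
Qed.

Lemma classical2_writhe : writhe_rule classical2_rule.
Proof.
move=> U V u v s t [k b].
case: u => [|e1 [|e2 [|? ?]]] // -[/forget_Vertex -> /forget_Vertex ->].
case: v => // _ /run_consP[s1 sV /run_consP[t1 sV' _]] _.
rewrite (word_writhe_cons _ sV) (word_writhe_cons _ sV') !vertex_signE.
have [-> ->] := act_Vertex sV.
by rewrite (crossing_sign_quarter (Classical b)) crossing_signC /= addr0 subrr.
Qed.

(** On both sides of the move each pair of strands crosses once, with the labels
these strands have at the bottom. *)
Lemma triangle_writhe k v12 v13 v23 u v s t :
  forget u = triangle_up k v12 v13 v23 -> forget v = triangle_down k v12 v13 v23 ->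
  run negb s u = Some t -> run negb s v = Some t ->
  word_writhe s u = word_writhe s v.
Proof.
case: u => [|? [|? [|? [|? ?]]]] // -[/forget_Vertex-> /forget_Vertex-> /forget_Vertex->].
case: v => [|? [|? [|? [|? ?]]]] // -[/forget_Vertex-> /forget_Vertex-> /forget_Vertex->].
move=> /run_consP[s1 V1 /run_consP[s2 V2 /run_consP[s3 V3 _]]].
move=> /run_consP[r1 W1 /run_consP[r2 W2 /run_consP[r3 W3 _]]].
rewrite (word_writhe_cons _ V1) (word_writhe_cons _ V2) (word_writhe_cons _ V3).
rewrite (word_writhe_cons _ W1) (word_writhe_cons _ W2) (word_writhe_cons _ W3).
rewrite !vertex_signE /= !addr0.
have [s1k s1k1] := act_Vertex V1.
have := act_above 0 V1; rewrite /= addn2 addn0 => s1k2.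
have [s2k1 _] := act_Vertex V2; have s2k := act_below (i := k) V2 (ltnSn k).
have [r1k1 r1k2] := act_Vertex W1; have r1k := act_below (i := k) W1 (ltnSn k).
have [_ r2k1] := act_Vertex W2.
have := act_above 0 W2; rewrite /= addn2 addn0 => r2k2.
rewrite s1k1 s1k2 s2k s2k1 s1k s1k2 r1k r1k1 r2k1 r2k2 r1k r1k2.
by rewrite addrCA [RHS]addrCA; congr (_ + _); apply: addrC.
Qed.

Lemma flat3_writhe : writhe_rule flat3_rule.
Proof. by move=> U V u v s t [k]; apply: triangle_writhe. Qed.

Lemma classical3_writhe : writhe_rule classical3_rule.
Proof. by move=> U V u v s t [k b12 b13 b23 _]; apply: triangle_writhe. Qed.

Lemma mixed3_writhe : writhe_rule mixed3_rule.
Proof. by move=> U V u v s t [k b|k b|k b]; apply: triangle_writhe. Qed.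

(** The maximum forces the label of the minimum to agree with that of the incoming
strand, so both strands point the same way at the vertex. *)
Lemma kink_right_writhe k b u s t :
  forget u = [:: Min k.+1 tt; Vertex k (Classical b); Max k.+1] ->
  run negb s u = Some t -> word_writhe s u = kink_sign b.
Proof.
case: u => [|? [|? [|? [|? ?]]]] //.
move=> -[/forget_Min[c ->] /forget_Vertex-> /forget_Max->].
move=> /run_consP[s1 sM /run_consP[s2 sV /run_consP[s3 sM' _]]].
rewrite (word_writhe_cons _ sM) (word_writhe_cons _ sV) (word_writhe_cons _ sM').
rewrite vertex_signE /= add0r !addr0.
have [s1k1 s1k2] := act_Min sM; have [_ s2k1] := act_Vertex sV.
have := act_above 0 sV; rewrite /= addn2 addn0 (act_Max sM') s2k1 s1k1 s1k2.
by move=> /negb_inj ->; rewrite eqxx; case: b {sV}.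
Qed.

Lemma kink_left_writhe k b u s t :
  forget u = [:: Min k tt; Vertex k.+1 (Classical b); Max k] ->
  run negb s u = Some t -> word_writhe s u = kink_sign b.
Proof.
case: u => [|? [|? [|? [|? ?]]]] //.
move=> -[/forget_Min[c ->] /forget_Vertex-> /forget_Max->].
move=> /run_consP[s1 sM /run_consP[s2 sV /run_consP[s3 sM' _]]].
rewrite (word_writhe_cons _ sM) (word_writhe_cons _ sV) (word_writhe_cons _ sM').
rewrite vertex_signE /= add0r !addr0.
have [s1k s1k1] := act_Min sM; have [s2k1 _] := act_Vertex sV.
have s2k := act_below (i := k) sV (ltnSn k).
have := act_Max sM'; rewrite s2k1 s2k s1k s1k1 => ->.
by rewrite eqxx; case: b {sV}.
Qed.

(** * The writhe under detours *)

Notation opart_word := (seq (event bool + bool * nat * bool)).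

(** An endpoint of the removed strand is the place where an uncoloured strand begins
(if it lies above that point) or ends. *)
Definition pact (s : seq bool) (x : event bool + bool * nat * bool) :
    option (seq bool) :=
  match x with
  | inl e => act negb s e
  | inr (true, k, c) => Some (take k s ++ c :: drop k s)
  | inr (false, k, _) => Some (take k s ++ drop k.+1 s)
  end.

Fixpoint prun (s : seq bool) (P : opart_word) : option (seq bool) :=
  if P is x :: P' then obind (prun^~ P') (pact s x) else Some s.

(** The writhe, computed from the uncoloured part alone. *)
Fixpoint pwrithe (s : seq bool) (P : opart_word) : int :=
  if P is x :: P' then
    (if x is inl e then vertex_sign s e else 0)
    + (if pact s x is Some s' then pwrithe s' P' else 0)
  else 0.

Lemma pwrithe_cat s t P Q : prun s P = Some t ->
  pwrithe s (P ++ Q) = pwrithe s P + pwrithe t Q.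
Proof.
elim: P s => [|x P IHP] s /=; first by move=> [<-]; rewrite add0r.
by case: (pact s x) => //= s' /IHP ->; rewrite addrA.
Qed.

Lemma pwrithe1 s x : pwrithe s [:: x] = if x is inl e then vertex_sign s e else 0.
Proof. by rewrite /=; case: (pact s x) => [?|]; rewrite addr0. Qed.

Lemma word_writhe1 s e : word_writhe s [:: e] = vertex_sign s e.
Proof. by rewrite /=; case: (act negb s e) => [?|]; rewrite addr0. Qed.

Definition uncoloured_labels (t : seq (bool * bool)) : seq bool :=
  [seq c.2 | c <- t & ~~ c.1].

Lemma uncoloured_labels_cat t u :
  uncoloured_labels (t ++ u) = uncoloured_labels t ++ uncoloured_labels u.
Proof. by rewrite /uncoloured_labels filter_cat map_cat. Qed.

Lemma uncoloured_labels_cons c t :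
  uncoloured_labels (c :: t) =
  if c.1 then uncoloured_labels t else c.2 :: uncoloured_labels t.
Proof. by rewrite /uncoloured_labels /=; case: c => [[] l]. Qed.

Lemma count_uncoloured (t : seq (bool * bool)) :
  count (fun c => c.1 == false) t = size (uncoloured_labels t).
Proof.
by rewrite size_map size_filter; apply: eq_count => -[[] c].
Qed.

Lemma run_uncolour t t' x : cact negb t x = Some t' ->
  run negb (map snd t) (uncolour x) = Some (map snd t').
Proof.
case: x => [[k [c l]|k|k v]|k] /=; rewrite ?size_map -?map_drop -?map_take.
- by case: ifP => // _ [<-]; rewrite map_cat.
- case: drop => [|[c l] [|[d l'] r]] //=; case: ifP => // /eqP[_ ->] [<-].
  by rewrite eqxx map_cat.
- case: ifP => // _.
  by case: drop => [|c [|d r]] //= [<-]; rewrite map_cat.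
- case Et: (drop k t) => [|c r] //= [<-]; have [p pk ->] := drop_consP Et.
  by rewrite take_size_cat // !map_cat.
Qed.

(** Only events among uncoloured strands, and changes of colour, affect the list of
the labels of the uncoloured strands. In particular a virtual vertex between a
coloured and an uncoloured strand does not. *)
Lemma pact_part t t' x : cact negb t x = Some t' ->
  prun (uncoloured_labels t) (part_event false t x) = Some (uncoloured_labels t').
Proof.
case: x => [[k [c l]|k|k v]|k] /=.
- case: ifP => // kt [<-].
  have [p [q [pk ->]]] : exists p q, size p = k /\ t = p ++ q.
    by exists (take k t), (drop k t); rewrite cat_take_drop size_takel.
  rewrite take_size_cat // drop_size_cat // count_uncoloured.
  rewrite !(uncoloured_labels_cat, uncoloured_labels_cons); case: c => //=.
  by rewrite size_cat leq_addr take_size_cat // drop_size_cat.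
- case Et: (drop k t) => [|[c l] [|[d l'] r]] //=.
  case: ifP Et => // /eqP[-> ->] Et [<-].
  have [p pk ->] := drop_consP Et; rewrite take_size_cat // take0 andbT.
  rewrite count_uncoloured
    !(uncoloured_labels_cat, uncoloured_labels_cons); case: c {Et} => //=.
  by rewrite drop_size_cat //= eqxx take_size_cat.
- case: ifP => // _; case Et: (drop k t) => [|[c l] [|[d l'] r]] //= [<-].
  have [p pk ->] := drop_consP Et; rewrite take_size_cat // take0 andbT.
  rewrite count_uncoloured
    !(uncoloured_labels_cat, uncoloured_labels_cons); case: c d {Et} => [] [] //=.
  by rewrite drop_size_cat //= take_size_cat.
- case Et: (drop k t) => [|[c l] r] //= [<-].
  have [p pk ->] := drop_consP Et; rewrite take_size_cat //.
  rewrite count_uncoloured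
    !(uncoloured_labels_cat, uncoloured_labels_cons); case: c {Et} => /=.
    by rewrite take_size_cat // drop_size_cat.
  rewrite take_size_cat // -[_ :: _]cat1s catA drop_size_cat //.
  by rewrite size_cat addn1.
Qed.

(** A vertex that is lost with the coloured strand is virtual and has no sign; at
the others both labels survive, next to each other. *)
Lemma pwrithe_part_event t t' x : cact negb t x = Some t' ->
  pwrithe (uncoloured_labels t) (part_event false t x) =
  word_writhe (map snd t) (uncolour x).
Proof.
case: x => [[k [c l]|k|k v]|k]; rewrite [cact _ _ _]/= [part_event _ _ _]/=.
- by move=> _; rewrite word_writhe1; case: ifP; rewrite ?pwrithe1.
- by move=> _; rewrite word_writhe1; case: ifP; rewrite ?pwrithe1.
- rewrite word_writhe1; case: ifP => // allow.
  case Et: (drop k t) allow => [|[c l] [|[d l'] r]] // allow _.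
  rewrite /= take0 orbF in allow; rewrite [take 2 _]/= take0 [all _ _]/= andbT.
  have [p pk ->] := drop_consP Et; rewrite take_size_cat // count_uncoloured.
  have -> : vertex_sign (map snd (p ++ [:: (c, l), (d, l') & r])) (Vertex k v) =
            crossing_sign v l l'.
    rewrite vertex_signE map_cat !nth_cat size_map pk ltnn subnn.
    by rewrite ltnNge leqnSn subSnn.
  case: c d allow {Et} => [] [] allow; try by rewrite (eqP allow).
  rewrite eqxx pwrithe1 vertex_signE.
  rewrite !(uncoloured_labels_cat, uncoloured_labels_cons) /=.
  by rewrite !nth_cat ltnn subnn ltnNge leqnSn subSnn.
- by case: drop => [|c r] // _; rewrite pwrithe1.
Qed.

Lemma writhe_part t t' R : crun negb t R = Some t' ->
  word_writhe (map snd t) (flatten [seq uncolour x | x <- R]) =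
  pwrithe (uncoloured_labels t) (part negb false t R).
Proof.
elim: R t => [//|x R IHR] t.
case tx: (cact negb t x) => [t''|]; last by rewrite /= tx.
rewrite (crun_cons _ tx) (part_cons _ _ tx) => /IHR IH.
rewrite (pwrithe_cat _ (pact_part tx)) (pwrithe_part_event tx) -IH.
by rewrite -(word_writhe_cat _ (run_uncolour tx)).
Qed.

Lemma writhe_detour (D D' : odiagram) : detour D D' -> writhe D = writhe D'.
Proof.
move=> [R [R' [[Rrun RD _] [Rrun' RD' _] parts]]].
rewrite /writhe -RD -RD' -[X in word_writhe X]/(map snd ([::] : seq (bool * bool))).
rewrite (writhe_part Rrun).
rewrite -[X in _ = word_writhe X _]/(map snd ([::] : seq (bool * bool))).
by rewrite (writhe_part Rrun') parts.
Qed.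

(** * The Jones polynomial *)

Lemma writhe_local (e : int) (D D' : odiagram) p u v q s t :
  word D = p ++ u ++ q -> word D' = p ++ v ++ q -> run negb [::] p = Some s ->
  run negb s u = Some t -> run negb s v = Some t ->
  word_writhe s u = e + word_writhe s v -> writhe D = e + writhe D'.
Proof.
move=> DE DE' prun urun vrun uv; rewrite /writhe DE DE'.
rewrite !(word_writhe_cat _ prun) (word_writhe_cat _ urun) (word_writhe_cat _ vrun).
by rewrite uv -(addrA e) [LHS]addrCA.
Qed.

(** It suffices that the factor of the bracket compensates the change of the
writhe. *)
Lemma jones_eq (e : int) (D D' : odiagram) :
  bracket (underlying D) = (- la) ^ (3 * e) *: bracket (underlying D') ->
  writhe D = e + writhe D' -> jones D = jones D'.
Proof.
move=> Db Dw; rewrite /jones Db Dw scalerA -exprzDr ?unitrN ?la_unit //.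
by congr (_ ^ _ *: _); ring.
Qed.

Lemma jones_rule rule (D D' : odiagram) : invariant_rule rule -> writhe_rule rule ->
  local_move rule D D' -> jones D = jones D'.
Proof.
move=> inv wr DD'; apply: (@jones_eq 0).
  rewrite mulr0 expr0z scale1r.
  exact: bracket_invariant_rule inv (local_move_underlying DD').
case: DD' => p [u [v [q [s [t [DE DE' [uv prun urun vrun]]]]]]].
by apply: (writhe_local DE DE' prun urun vrun); rewrite add0r;
  apply: wr uv _ _ urun vrun.
Qed.

Lemma kink_local U V u v s t : classical1_rule U V ->
  forget u = U -> forget v = V -> run negb s u = Some t ->
  exists e, word_writhe s u = e + word_writhe s v /\
    forall f, flat_invariant (size s) f ->
      expand U f = (- la) ^ (3 * e) *: expand V f.
Proof.
move=> uv uU vV urun; have hU := run_size (run_forget urun).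
rewrite size_map uU in hU.
case: uv uU vV hU => k b uU; case: v => // _ hU; exists (kink_sign b);
  rewrite addr0; split=> [|f fP].
- exact: kink_right_writhe uU urun.
- by apply: (expand_kink_right b _ fP); move: hU => /=; case: ifP.
- exact: kink_left_writhe uU urun.
- apply: (expand_kink_left b _ fP); move: hU => /=; case: ifP => //= _.
  by case: ifP.
Qed.

Lemma jones_kink (D D' : odiagram) :
  local_move classical1_rule D D' -> jones D = jones D'.
Proof.
case=> p [u [v [q [s [t [DE DE' [uv prun urun vrun]]]]]]].
have [e [uve expand_uv]] := kink_local uv erefl erefl urun.
apply: (@jones_eq e); last exact: (writhe_local DE DE' prun urun vrun uve).
have /= prun' := run_size (run_forget prun); rewrite size_map in prun'.
by apply: (bracket_local _ _ prun' expand_uv); rewrite /= ?DE ?DE' !map_cat.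
Qed.

Lemma jones_detour (D D' : odiagram) : detour D D' -> jones D = jones D'.
Proof.
move=> DD'; apply: (@jones_eq 0); last by rewrite add0r (writhe_detour DD').
by rewrite mulr0 expr0z scale1r (bracket_detour (detour_underlying DD')).
Qed.

Lemma jones_invariant m (D D' : odiagram) : related_by m D D' -> jones D = jones D'.
Proof.
case: m => /=.
- exact: jones_rule isotopy_invariant isotopy_writhe.
- exact: jones_kink.
- exact: jones_rule classical2_invariant classical2_writhe.
- exact: jones_rule classical3_invariant classical3_writhe.
- exact: jones_rule flat2_invariant flat2_writhe.
- exact: jones_rule flat3_invariant flat3_writhe.
- exact: jones_rule mixed3_invariant mixed3_writhe.
- exact: jones_detour.
Qed.

Theorem theorem6 :
  (forall (m : move) (K K' : udiagram),
     m <> ClassicalR1 -> related_by m K K' -> bracket K = bracket K') /\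
  (forall D D' : odiagram, same_link D D' -> jones D = jones D').
Proof.
split; first exact: bracket_invariant.
move=> D D'; elim=> {D D'} [D D' [m]|//|D D' _ ->//|D D' D'' _ -> _ ->//].
exact: jones_invariant.
Qed.
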